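(* Let $E$ be a finite set, $S=\mathbb{C}[x_e:e\in E]$, and let $I\subset S$ be a standard-homogeneous ideal that contains no monomial. Let $w\in\mathbb{R}^E$ be such that $\operatorname{in}_wI$ contains no monomial, and let $\Theta=\operatorname{subd}_w\mathcal A(I)$. For each cell $\Delta$, let $X^\circ_\Delta=\operatorname{Spec}R^\circ_\Delta$, where $R^\circ_\Delta$ is the degree-$0$ part of $\mathbb{C}[\Delta]^\circ/\rho_\Delta(I)\mathbb{C}[\Delta]^\circ$. For $\Delta\subset\Gamma$, let $X^\circ_\Gamma\to X^\circ_\Delta$ be induced by $\mathbb{C}[\Delta]^\circ\subset\mathbb{C}[\Gamma]^\circ$. Let $I^\circ_w\subset S^\circ$ be the ideal generated by all subspaces $\rho_\Delta(I)\subset S^\circ$, $\Delta\in\Theta$. Let $R^\circ_w$ be the degree-$0$ part of $S^\circ/I^\circ_w$, and $X^\circ_w=\operatorname{Spec}R^\circ_w$. If every $a_e$, $e\in E$, lies in some cell of $\Theta$, then $$\varprojlim_{\mathbf J(\Theta)^{\mathrm{op}}}X^\circ_\Delta\cong X^\circ_w$$ (limit in the category of affine schemes).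
   Context: $\operatorname{in}_wp$ is the sum of the terms of $p$ of minimal $w$-weight, and $\operatorname{in}_wI$ is the ideal they generate. $\mathcal L(I)=\{w:\operatorname{in}_wI=I\}$. $\mathcal A(I)=(a_e)_{e\in E}\subset\mathcal L(I)^*$, where $a_e$ is the restriction of the $e$-th coordinate functional. $\operatorname{subd}_wA$, for $A=(a_e)$ in $V$, is the set of cells $(a_e)_{e\in E_f}$, for $f\in V^*$, with $E_f$ the set of $e$ minimizing $f(a_e)+w_e$. We write $a_e\in\Delta$ if $e$ is a label of $\Delta$. $\mathbf J(\Theta)$ is the poset category of cells under inclusion. $S^\circ=\mathbb{C}[x_e^{\pm1}]$ and $\mathbb{C}[\Delta]^\circ=\mathbb{C}[x_e^{\pm1}:a_e\in\Delta]$. $\rho_\Delta:S\to\mathbb{C}[x_e:a_e\in\Delta]$ kills the other variables. Degree-$0$ part is taken with respect to the standard $\mathbb{Z}$-grading. *)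

(* Defs.v *)
From HB Require Import structures.
From mathcomp Require Import all_boot all_order all_algebra.
From mathcomp Require Import boolp reals.
From mathcomp Require Import complex.
From mathcomp Require Import zify lra.
From mathcomp.multinomials Require Import mpoly.

Set Implicit Arguments.
Unset Strict Implicit.
Unset Printing Implicit Defensive.

Import Order.TTheory GRing.Theory Num.Theory.
Local Open Scope ring_scope.
#[local] Obligation Tactic := idtac.

Record category := Category {
  obj :> Type;
  hom : obj -> obj -> Type;
  idm : forall x, hom x x;
  comp : forall x y z, hom y z -> hom x y -> hom x z;
  comp1m : forall x y (f : hom x y), comp (idm y) f = f;
  compm1 : forall x y (f : hom x y), comp f (idm x) = f;
  compA : forall x y z t (h : hom z t) (g : hom y z) (f : hom x y),
    comp h (comp g f) = comp (comp h g) f }.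

Arguments hom {_} _ _.
Arguments idm {_} _.
Arguments comp {_ _ _ _} _ _.

Definition opposite (K : category) : category :=
  @Category (obj K) (fun x y => @hom K y x) (fun x => @idm K x)
    (fun x y z g f => @comp K z y x f g)
    (fun x y f => @compm1 K y x f) (fun x y f => @comp1m K y x f)
    (fun x y z t h g f => esym (@compA K t z y x f g h)).

Definition isomorphic (K : category) (x y : K) : Prop :=
  exists (f : hom x y) (g : hom y x), comp g f = idm x /\ comp f g = idm y.

Record functor (K L : category) := Functor {
  fobj :> K -> L;
  fmap : forall x y, hom x y -> hom (fobj x) (fobj y);
  fmap1 : forall x, fmap (idm x) = idm (fobj x);
  fmapM : forall x y z (g : hom y z) (f : hom x y),
    fmap (comp g f) = comp (fmap g) (fmap f) }.

Arguments fmap {_ _} _ {_ _} _.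

Section Limits.
Variables (J K : category) (D : functor J K).

Record cone (x : K) := Cone {
  leg :> forall j : J, hom x (D j);
  leg_natural : forall (i j : J) (u : hom i j),
    comp (fmap D u) (leg i) = leg j }.

Definition is_limit (x : K) (c : cone x) : Prop :=
  forall (y : K) (c' : cone y),
    exists! h : hom y x, forall j : J, comp (c j) h = c' j.

End Limits.

Section FunctorCategory.
Variables K L : category.

Record nat_trans (F G : functor K L) := NatTrans {
  component :> forall x, hom (F x) (G x);
  component_natural : forall x y (f : hom x y),
    comp (component y) (fmap F f) = comp (fmap G f) (component x) }.

Lemma nat_trans_ext (F G : functor K L) (s t : nat_trans F G) :
  (forall x, s x = t x) -> s = t.
Proof.
case: s t => [s sn] [t tn] /= st.
have e := functional_extensionality_dep st; subst t.
by congr NatTrans; apply: Prop_irrelevance.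
Qed.

Program Definition nat_id (F : functor K L) : nat_trans F F :=
  @NatTrans F F (fun x => idm (F x)) _.
Next Obligation. by move=> F x y f; rewrite comp1m compm1. Qed.

Program Definition nat_comp (F G H : functor K L)
    (t : nat_trans G H) (s : nat_trans F G) : nat_trans F H :=
  @NatTrans F H (fun x => comp (t x) (s x)) _.
Next Obligation.
move=> F G H t s x y f.
by rewrite -compA component_natural compA component_natural compA.
Qed.

Program Definition functor_cat : category :=
  @Category (functor K L) nat_trans nat_id nat_comp _ _ _.
Next Obligation. by move=> F G s; apply: nat_trans_ext => x; apply: comp1m. Qed.
Next Obligation. by move=> F G s; apply: nat_trans_ext => x; apply: compm1. Qed.
Next Obligation. by move=> *; apply: nat_trans_ext => x; apply: compA. Qed.

End FunctorCategory.

Definition type_cat : category :=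
  @Category Type (fun A B => A -> B) (fun A => id) (fun A B C g f => g \o f)
    (fun A B f => erefl) (fun A B f => erefl) (fun A B C D h g f => erefl).

Lemma rmorphism_ext (A B : comPzRingType) (f g : {rmorphism A -> B}) :
  f =1 g -> f = g.
Proof.
case: f g => [f [[f1] [f2]]] [g [[g1] [g2]]] /= fg.
have e := funext fg; subst g.
by rewrite (Prop_irrelevance f1 g1) (Prop_irrelevance f2 g2).
Qed.

Program Definition ring_cat : category :=
  @Category comPzRingType (fun A B => {rmorphism A -> B})
    (fun A => idfun : {rmorphism A -> A})
    (fun A B C g f => g \o f : {rmorphism A -> C}) _ _ _.
Next Obligation. by move=> A B f; apply: rmorphism_ext. Qed.
Next Obligation. by move=> A B f; apply: rmorphism_ext. Qed.
Next Obligation. by move=> A B C D h g f; apply: rmorphism_ext. Qed.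

(* Functor of points: Spec A is the functor B |-> Hom(A, B) on commutative
   rings, and an affine scheme is a functor isomorphic to some Spec A. *)
Program Definition Spec_points (A : comPzRingType) :
    functor ring_cat type_cat :=
  @Functor ring_cat type_cat (fun B => {rmorphism A -> B})
    (fun B C h => fun g => h \o g : {rmorphism A -> C}) _ _.
Next Obligation.
by move=> A B; apply: functional_extensionality_dep => g; apply: rmorphism_ext.
Qed.
Next Obligation.
move=> A B C D h k; apply: functional_extensionality_dep => g.
exact: rmorphism_ext.
Qed.

Record affine_scheme := AffineScheme {
  points : functor_cat ring_cat type_cat;
  points_representable :
    exists A : comPzRingType, isomorphic points (Spec_points A) }.

Definition affine_scheme_cat : category :=
  @Category affine_scheme (fun X Y => hom (points X) (points Y))
    (fun X => idm (points X)) (fun X Y Z g f => comp g f)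
    (fun X Y f => comp1m f) (fun X Y f => compm1 f)
    (fun X Y Z T h g f => compA h g f).

Program Definition Spec (A : comPzRingType) : affine_scheme_cat :=
  @AffineScheme (Spec_points A) _.
Next Obligation.
by move=> A; exists A, (idm _), (idm _); rewrite !comp1m.
Qed.

Program Definition Spec_map (A B : comPzRingType) (f : {rmorphism A -> B}) :
    @hom affine_scheme_cat (Spec B) (Spec A) :=
  @NatTrans _ _ (Spec_points B) (Spec_points A)
    (fun T => fun g => g \o f : {rmorphism A -> T}) _.
Next Obligation.
move=> A B f T U h; apply: functional_extensionality_dep => g.
exact: rmorphism_ext.
Qed.

Lemma Spec_map1 (A : comPzRingType) (f : {rmorphism A -> A}) :
  f =1 id -> Spec_map f = idm (Spec A).
Proof.
move=> fE; apply: nat_trans_ext => T; apply: functional_extensionality_dep => g.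
by apply: rmorphism_ext => x /=; rewrite fE.
Qed.

Lemma Spec_mapM (A B C : comPzRingType) (g : {rmorphism B -> C})
    (f : {rmorphism A -> B}) (h : {rmorphism A -> C}) :
  h =1 g \o f -> Spec_map h = comp (Spec_map f) (Spec_map g).
Proof.
move=> hE; apply: nat_trans_ext => T; apply: functional_extensionality_dep => k.
by apply: rmorphism_ext => x /=; rewrite hE.
Qed.

Section Subring.
Variable A : comPzRingType.

Record subring := Subring {
  subring_set :> A -> Prop;
  subring1 : subring_set 1;
  subringB : forall x y, subring_set x -> subring_set y -> subring_set (x - y);
  subringM : forall x y,
    subring_set x -> subring_set y -> subring_set (x * y) }.

Variable P : subring.

Definition subring_pred : {pred A} := fun x => `[< P x >].

Lemma subring_pred_closed : subring_closed subring_pred.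
Proof.
split=> [|x y|x y]; first by apply/asboolP; apply: subring1.
- by move=> /asboolP Px /asboolP Py; apply/asboolP; apply: subringB.
- by move=> /asboolP Px /asboolP Py; apply/asboolP; apply: subringM.
Qed.

HB.instance Definition _ :=
  GRing.isSubringClosed.Build A subring_pred subring_pred_closed.

Definition subring_type := {x : A | subring_pred x}.

HB.instance Definition _ := [isSub of subring_type for @sval A subring_pred].
HB.instance Definition _ := [Choice of subring_type by <:].
HB.instance Definition _ :=
  GRing.SubChoice_isSubComPzRing.Build A subring_pred subring_type
    (subringClosedP _).

Lemma subring_typeP (x : subring_type) : P (val x).
Proof. by apply/asboolP; case: x. Qed.

Definition subring_elt (x : A) (Px : P x) : subring_type :=
  exist _ x (asboolT Px).

End Subring.

Section SubringMap.
Variables (A B : comPzRingType) (P : subring A) (Q : subring B).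
Variable f : {rmorphism A -> B}.
Hypothesis fPQ : forall x, P x -> Q (f x).

Definition subring_map (x : subring_type P) : subring_type Q :=
  subring_elt (fPQ (subring_typeP x)).

Lemma val_subring_map x : val (subring_map x) = f (val x).
Proof. by []. Qed.

Lemma subring_map_zmod : zmod_morphism subring_map.
Proof. by move=> x y; apply: val_inj; rewrite /= rmorphB. Qed.

Lemma subring_map_monoid : monoid_morphism subring_map.
Proof.
split; first by apply: val_inj; rewrite /= rmorph1.
by move=> x y; apply: val_inj; rewrite /= rmorphM.
Qed.

HB.instance Definition _ := GRing.isZmodMorphism.Build
  (subring_type P) (subring_type Q) subring_map subring_map_zmod.
HB.instance Definition _ := GRing.isMonoidMorphism.Build
  (subring_type P) (subring_type Q) subring_map subring_map_monoid.

End SubringMap.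

Section Ideal.
Variable A : comPzRingType.

Record ideal := Ideal {
  ideal_set :> A -> Prop;
  ideal0 : ideal_set 0;
  idealD : forall x y, ideal_set x -> ideal_set y -> ideal_set (x + y);
  idealMl : forall a x, ideal_set x -> ideal_set (a * x) }.

Program Definition ideal_gen (G : A -> Prop) : ideal :=
  @Ideal (fun x => forall J : ideal, (forall y, G y -> J y) -> J x) _ _ _.
Next Obligation. by move=> G J _; apply: ideal0. Qed.
Next Obligation.
by move=> G x y Gx Gy J GJ; apply: idealD; [apply: Gx | apply: Gy].
Qed.
Next Obligation. by move=> G a x Gx J GJ; apply: idealMl; apply: Gx. Qed.

Lemma ideal_gen_sub (G : A -> Prop) x : G x -> ideal_gen G x.
Proof. by move=> Gx J; apply. Qed.

Variable J : ideal.

Lemma idealN x : J x -> J (- x).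
Proof. by rewrite -mulN1r; apply: idealMl. Qed.

Lemma idealB x y : J x -> J y -> J (x - y).
Proof. by move=> Jx Jy; apply: idealD => //; apply: idealN. Qed.

Lemma ideal_sum (I : Type) (r : seq I) (Q : pred I) (F : I -> A) :
  (forall i, Q i -> J (F i)) -> J (\sum_(i <- r | Q i) F i).
Proof. by move=> JF; apply: big_ind => //; [exact: ideal0|exact: idealD]. Qed.

Definition ideal_equiv (x y : A) : bool := `[< J (x - y) >].

Lemma ideal_equiv_is_equiv : equiv_class_of ideal_equiv.
Proof.
split=> [x|x y|y x z].
- by apply/asboolP; rewrite subrr; apply: ideal0.
- by apply/asboolP/asboolP => /idealN; rewrite opprB.
- move=> /asboolP xy /asboolP yz; apply/asboolP.
  by rewrite -(subrKA y); apply: idealD.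
Qed.

Canonical ideal_equiv_rel := EquivRelPack ideal_equiv_is_equiv.
Canonical ideal_equiv_encModRel := defaultEncModRel ideal_equiv.

Local Open Scope quotient_scope.

Definition quot := {eq_quot ideal_equiv}.
HB.instance Definition _ : EqQuotient A ideal_equiv quot :=
  EqQuotient.on quot.
HB.instance Definition _ := Choice.on quot.

Lemma quot_eqP (x y : A) : \pi_quot x = \pi_quot y <-> J (x - y).
Proof. by split=> [/eqmodP/asboolP|Jxy]; [|apply/eqmodP/asboolP]. Qed.

Definition quot_zero : quot := \pi_quot 0.
Definition quot_one : quot := \pi_quot 1.
Definition quot_opp (x : quot) : quot := \pi_quot (- repr x).
Definition quot_add (x y : quot) : quot := \pi_quot (repr x + repr y).
Definition quot_mul (x y : quot) : quot := \pi_quot (repr x * repr y).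

Lemma quot_reprP x : J (repr (\pi_quot x) - x).
Proof. by apply/quot_eqP; rewrite reprK. Qed.

Lemma quot_ind (T : quot -> Prop) : (forall x, T (\pi_quot x)) -> forall u, T u.
Proof. by move=> Tpi u; rewrite -[u]reprK. Qed.

Lemma quot_oppE x : quot_opp (\pi_quot x) = \pi_quot (- x).
Proof.
by apply/quot_eqP; rewrite -opprD; apply: idealN; apply: quot_reprP.
Qed.

Lemma quot_addE x y : quot_add (\pi_quot x) (\pi_quot y) = \pi_quot (x + y).
Proof.
by apply/quot_eqP; rewrite opprD addrACA; apply: idealD; apply: quot_reprP.
Qed.

Lemma quot_mulE x y : quot_mul (\pi_quot x) (\pi_quot y) = \pi_quot (x * y).
Proof.
apply/quot_eqP; set x' := repr _; set y' := repr _.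
rewrite -(subrKA (x' * y)) -mulrBr -mulrBl [X in _ + X]mulrC.
by apply: idealD; apply: idealMl; apply: quot_reprP.
Qed.

Lemma quot_addA : associative quot_add.
Proof.
elim/quot_ind=> x; elim/quot_ind=> y; elim/quot_ind=> z.
by rewrite !quot_addE addrA.
Qed.

Lemma quot_addC : commutative quot_add.
Proof.
by elim/quot_ind=> x; elim/quot_ind=> y; rewrite !quot_addE addrC.
Qed.

Lemma quot_add0 : left_id quot_zero quot_add.
Proof. by elim/quot_ind=> x; rewrite quot_addE add0r. Qed.

Lemma quot_addN : left_inverse quot_zero quot_opp quot_add.
Proof. by elim/quot_ind=> x; rewrite quot_oppE quot_addE addNr. Qed.

Lemma quot_mulA : associative quot_mul.
Proof.
elim/quot_ind=> x; elim/quot_ind=> y; elim/quot_ind=> z.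
by rewrite !quot_mulE mulrA.
Qed.

Lemma quot_mulC : commutative quot_mul.
Proof.
by elim/quot_ind=> x; elim/quot_ind=> y; rewrite !quot_mulE mulrC.
Qed.

Lemma quot_mul1 : left_id quot_one quot_mul.
Proof. by elim/quot_ind=> x; rewrite quot_mulE mul1r. Qed.

Lemma quot_mulDl : left_distributive quot_mul quot_add.
Proof.
elim/quot_ind=> x; elim/quot_ind=> y; elim/quot_ind=> z.
by rewrite !(quot_mulE, quot_addE) mulrDl.
Qed.

HB.instance Definition _ :=
  GRing.isZmodule.Build quot quot_addA quot_addC quot_add0 quot_addN.
HB.instance Definition _ := GRing.Zmodule_isComPzRing.Build quot
  quot_mulA quot_mulC quot_mul1 quot_mulDl.

Definition quot_pi (x : A) : quot := \pi_quot x.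

Lemma quot_piB : zmod_morphism quot_pi.
Proof.
move=> x y; rewrite /quot_pi; change (\pi_quot (x - y) =
  quot_add (\pi_quot x) (quot_opp (\pi_quot y))).
by rewrite quot_oppE quot_addE.
Qed.

Lemma quot_piM : monoid_morphism quot_pi.
Proof. by split=> // x y; rewrite /quot_pi -quot_mulE. Qed.

HB.instance Definition _ := GRing.isZmodMorphism.Build A quot quot_pi quot_piB.
HB.instance Definition _ :=
  GRing.isMonoidMorphism.Build A quot quot_pi quot_piM.

Lemma quot_pi_eq (x y : A) : quot_pi x = quot_pi y <-> J (x - y).
Proof. exact: quot_eqP. Qed.

Lemma quot_pi_ind (T : quot -> Prop) :
  (forall x, T (quot_pi x)) -> forall u, T u.
Proof. exact: quot_ind. Qed.

End Ideal.

Section QuotientMap.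
Variables (A B : comPzRingType) (J : ideal A) (K : ideal B).
Variable f : {rmorphism A -> B}.

Definition quot_map_def (_ : forall x, J x -> K (f x)) (u : quot J) : quot K :=
  quot_pi K (f (repr u)).

Hypothesis fJK : forall x, J x -> K (f x).

Lemma quot_map_defE x : (quot_map_def fJK) (quot_pi J x) = quot_pi K (f x).
Proof.
apply/quot_pi_eq; rewrite -rmorphB; apply: fJK.
exact: quot_reprP.
Qed.

Lemma quot_map_def_zmod : zmod_morphism (quot_map_def fJK).
Proof.
elim/quot_pi_ind=> x; elim/quot_pi_ind=> y.
by rewrite -rmorphB !quot_map_defE !rmorphB.
Qed.

Lemma quot_map_def_monoid : monoid_morphism (quot_map_def fJK).
Proof.
split; first by rewrite -(rmorph1 (quot_pi J)) quot_map_defE !rmorph1.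
elim/quot_pi_ind=> x; elim/quot_pi_ind=> y.
by rewrite -rmorphM !quot_map_defE !rmorphM.
Qed.

HB.instance Definition _ := GRing.isZmodMorphism.Build
  (quot J) (quot K) (quot_map_def fJK) quot_map_def_zmod.
HB.instance Definition _ := GRing.isMonoidMorphism.Build
  (quot J) (quot K) (quot_map_def fJK) quot_map_def_monoid.

Definition quot_map : {rmorphism quot J -> quot K} := quot_map_def fJK.

Lemma quot_mapE x : quot_map (quot_pi J x) = quot_pi K (f x).
Proof. exact: quot_map_defE. Qed.

End QuotientMap.

Lemma ideal_gen_map (A B : comPzRingType) (G : A -> Prop) (K : ideal B)
    (f : {rmorphism A -> B}) :
  (forall x, G x -> K (f x)) -> forall x, ideal_gen G x -> K (f x).
Proof.
move=> GK x Gx.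
have p0 : K (f 0) by rewrite rmorph0; apply: ideal0.
have pD y z : K (f y) -> K (f z) -> K (f (y + z)).
  by rewrite rmorphD; apply: idealD.
have pM a y : K (f y) -> K (f (a * y)) by rewrite rmorphM; apply: idealMl.
exact: (Gx (@Ideal A (fun y => K (f y)) p0 pD pM)).
Qed.

Lemma vspace_of_closed (K : fieldType) (V : vectType K) (P : V -> Prop) :
  P 0 -> (forall (a : K) u v, P u -> P v -> P (a *: u + v)) ->
  exists U : {vspace V}, forall v, v \in U <-> P v.
Proof.
move=> P0 PD.
pose Q n := `[< exists U : {vspace V},
  \dim U = n /\ (forall v, v \in U -> P v) >].
have exQ : exists n, Q n.
  exists 0%N; apply/asboolP; exists 0%VS; split; first by rewrite dimv0.
  by move=> v; rewrite memv0 => /eqP ->.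
have leQ n : Q n -> (n <= \dim {: V})%N.
  by move=> /asboolP[U [<- _]]; apply: dimvS; apply: subvf.
case: (ex_maxnP exQ leQ) => n /asboolP[U [dU UP]] maxn.
exists U => v; split=> [/UP//|Pv].
have UvP x : x \in (U + <[v]>)%VS -> P x.
  move=> /memv_addP[u uU [y /vlineP[a ->] ->]].
  by rewrite addrC; apply: PD => //; apply: UP.
have /maxn : Q (\dim (U + <[v]>)) by apply/asboolP; exists (U + <[v]>)%VS.
rewrite -dU => le_dim.
have /eqP -> : U == (U + <[v]>)%VS by rewrite eqEdim addvSl.
by apply: subvP (addvSr _ _) _ (memv_line v).
Qed.

Lemma bidual_eval (K : fieldType) (V : vectType K)
    (f : 'Hom('Hom(V, K^o), K^o)) : exists v : V, forall a, f a = a v.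
Proof.
pose b := vbasis (fullv : {vspace V}).
pose c i : 'Hom(V, K^o) := linfun (coord b i : V -> K^o).
exists (\sum_(i < \dim (fullv : {vspace V})) f (c i) *: b`_i) => a.
have -> : a = \sum_(i < \dim (fullv : {vspace V})) a b`_i *: c i.
  apply/lfunP => v; rewrite sum_lfunE {1}(coord_vbasis (memvf v)) linear_sum.
  apply: eq_bigr => i _; rewrite linearZ scale_lfunE lfunE /=.
  by rewrite /GRing.scale /= mulrC.
rewrite linear_sum sum_lfunE; apply: eq_bigr => j _.
rewrite linearZ scale_lfunE lfunE /= linear_sum (bigD1 j) //= big1 ?addr0.
  rewrite linearZ /= coord_free ?eqxx ?mulr1 //; exact: basis_free (vbasisP _).
move=> i ij; rewrite linearZ /= coord_free; last exact: basis_free (vbasisP _).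

by rewrite (negPf ij) mulr0.
Qed.

Section Monomials.
Variables (k : comNzRingType) (n : nat).
Local Notation S := {mpoly k[n]}.
Local Notation M := 'X_{1..n}.

Definition mselect (P : pred M) (p : S) : S :=
  \sum_(m <- msupp p | P m) p@_m *: 'X_[m].

Lemma mcoeff_mselect P p m : (mselect P p)@_m = if P m then p@_m else 0.
Proof.
rewrite raddf_sum /= (eq_bigr (fun m' => p@_m' * (m' == m)%:R)); last first.
  by move=> m' _; rewrite mcoeffZ mcoeffX.
have [mp|mp] := boolP (m \in msupp p).
  have [Pm|/negPf Pm] := boolP (P m).
    rewrite -big_filter (bigD1_seq m) ?mem_filter ?Pm ?filter_uniq //=.
    rewrite eqxx mulr1 big1 ?addr0 // => m' /negPf ->.
    by rewrite mulr0.
  rewrite big1 // => m' Pm'; case: eqP => [e|_]; last by rewrite mulr0.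
  by rewrite -e Pm' in Pm.
rewrite (memN_msupp_eq0 mp) if_same big_seq_cond big1 // => m' /andP[m'p _].
by case: eqP => [e|_]; rewrite ?mulr0 //; rewrite -e m'p in mp.
Qed.

Lemma mselectB P : {morph mselect P : p q / p - q}.
Proof.
move=> p q; apply/mpolyP => m; rewrite !(mcoeffB, mcoeff_mselect).
by case: (P m); rewrite ?subr0.
Qed.

Lemma mselect0 P : mselect P 0 = 0.
Proof. by rewrite -[in LHS](subrr 0) mselectB subrr. Qed.

Lemma mselect_sum P (I : Type) (r : seq I) (F : I -> S) :
  mselect P (\sum_(i <- r) F i) = \sum_(i <- r) mselect P (F i).
Proof.
apply/mpolyP => m; rewrite mcoeff_mselect !raddf_sum /=.
case: ifPn => Pm; last first.
  by rewrite big1 // => i _; rewrite mcoeff_mselect (negPf Pm).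
by apply: eq_bigr => i _; rewrite mcoeff_mselect Pm.
Qed.

Lemma msupp_mselect P p m :
  (m \in msupp (mselect P p)) = P m && (m \in msupp p).
Proof. by rewrite !mcoeff_msupp mcoeff_mselect; case: (P m); rewrite ?eqxx. Qed.

Lemma mselect_comp P Q p : mselect P (mselect Q p) = mselect (predI P Q) p.
Proof.
by apply/mpolyP => m; rewrite !mcoeff_mselect /=; case: (P m).
Qed.

Lemma mselect_id (P : pred M) p :
  (forall m, m \in msupp p -> P m) -> mselect P p = p.
Proof.
move=> Pp; apply/mpolyP => m; rewrite mcoeff_mselect; case: ifPn => // Pm.
by rewrite memN_msupp_eq0 //; apply: contra Pm; apply: Pp.
Qed.

Lemma mselect_none (P : pred M) p :
  (forall m, m \in msupp p -> ~~ P m) -> mselect P p = 0.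
Proof.
move=> Pp; apply/mpolyP => m; rewrite mcoeff_mselect mcoeff0.
case: ifPn => // Pm.
by rewrite memN_msupp_eq0 //; apply: contraL Pm; apply: Pp.
Qed.

Lemma mselect_eq (P Q : pred M) p :
  {in msupp p, P =1 Q} -> mselect P p = mselect Q p.
Proof.
move=> PQ; apply/mpolyP => m; rewrite !mcoeff_mselect.
have [/PQ->//|/memN_msupp_eq0->] := boolP (m \in msupp p).
by rewrite !if_same.
Qed.

Lemma mselect_partition (T : eqType) (h : M -> T) p :
  p = \sum_(t <- undup (map h (msupp p))) mselect (fun m => h m == t) p.
Proof.
apply/mpolyP => m; rewrite raddf_sum /=.
rewrite (eq_bigr (fun t => if t == h m then p@_m else 0)); last first.
  by move=> t _; rewrite mcoeff_mselect eq_sym.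
rewrite -big_mkcond /=.
have [mp|/memN_msupp_eq0->] := boolP (m \in msupp p); last by rewrite big1.
rewrite -big_filter (bigD1_seq (h m)) ?filter_uniq ?undup_uniq //=; last first.
  by rewrite mem_filter eqxx mem_undup map_f.
rewrite big_filter_cond big_pred0 ?addr0 // => t.
by case: eqP.
Qed.

End Monomials.

Section Degeneration.
Variables (R : realType) (E : finType).
Local Notation C := R[i].
Local Notation S := {mpoly C[#|E|]}.
Local Notation M := 'X_{1..#|E|}.

(* The variable x_e is 'X_(enum_rank e). *)
Definition weight (w : E -> R) (m : M) : R :=
  \sum_(i < #|E|) w (enum_val i) *+ m i.

Definition initial_form (w : E -> R) (p : S) : S :=
  \sum_(m <- msupp p | all (fun m' => weight w m <= weight w m') (msupp p))
    p@_m *: 'X_[m].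

Definition initial_ideal (w : E -> R) (I : ideal S) : ideal S :=
  ideal_gen (fun q => exists2 p, I p & q = initial_form w p).

Definition contains_no_monomial (I : ideal S) : Prop :=
  forall m : M, ~ I 'X_[m].

Definition homogeneous_ideal (I : ideal S) : Prop :=
  forall (d : nat) (p : S), I p -> I (pihomog mdeg d p).

Definition lineality_set (I : ideal S) (w : {ffun E -> R^o}) : Prop :=
  forall p, initial_ideal w I p <-> I p.

Definition weight_homogeneous (w : E -> R) (I : ideal S) : Prop :=
  forall c p, I p -> I (mselect (fun m => weight w m == c) p).

Lemma exists_min_weight (w : E -> R) (s : seq M) : s != [::] ->
  exists2 m, m \in s & forall m', m' \in s -> weight w m <= weight w m'.
Proof.
elim: s => // a s IH _; have [->|/IH[m ms mmin]] := eqVneq s [::].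
  by exists a => [|m']; rewrite inE // => /eqP->.
have [am|/ltW ma] := leP (weight w a) (weight w m).
  exists a => [|m']; rewrite ?mem_head // inE => /orP[/eqP->//|/mmin].
  exact: le_trans.
by exists m => [|m']; rewrite inE ?ms ?orbT // => /orP[/eqP->//|/mmin].
Qed.

Lemma initial_formE (w : E -> R) (p : S) m : m \in msupp p ->
  (forall m', m' \in msupp p -> weight w m <= weight w m') ->
  initial_form w p = mselect (fun m' => weight w m' == weight w m) p.
Proof.
move=> mp mmin; apply: mselect_eq => m' m'p /=.
apply/allP/eqP => [m'min|->//]; apply/eqP.
by rewrite eq_le m'min // mmin.
Qed.

Lemma lineality_setP I (w : {ffun E -> R^o}) :
  lineality_set I w <-> weight_homogeneous w I.
Proof.
split=> [Lw c p|hI p]; last first.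
  split=> [|Ip].
    rewrite -[p]/(idfun p).
    apply: (ideal_gen_map (f := idfun)) => q [r Ir ->] /=.
    have [->|] := eqVneq r 0.
      by rewrite /initial_form msupp0 big_nil; apply: ideal0.
    rewrite -msupp_eq0 => /(exists_min_weight w)[m mr /(initial_formE mr)->].
    exact: hI.
  rewrite (mselect_partition (weight w) p); apply: ideal_sum => t _.
  set q := mselect _ p; have Iq : I q by apply: hI.
  have qt m : m \in msupp q -> weight w m = t.
    by rewrite msupp_mselect => /andP[/eqP].
  apply: ideal_gen_sub; exists q => //.
  rewrite /initial_form -/(mselect _ q) mselect_id // => m mq.
  by apply/allP => m' m'q; rewrite !qt.
have [N] := ubnP (size (msupp p)); elim: N p => // N IH p.
rewrite ltnS => pN Ip; have [p0|] := eqVneq p 0.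
  by rewrite p0 mselect0; apply: ideal0.
rewrite -msupp_eq0 => /(exists_min_weight w)[m mp /(initial_formE mp) qE].
set q := initial_form w p in qE; have Iq : I q.
  by apply/Lw; apply: ideal_gen_sub; exists p.
have -> : mselect (fun m' => weight w m' == c) p =
    mselect (fun m' => weight w m' == c) (p - q) +
    mselect (fun m' => weight w m' == c) q by rewrite mselectB subrK.
apply: idealD.
  apply: IH; last exact: idealB.
  apply: leq_trans pN.
  rewrite -[(size _).+1]/(size (m :: msupp (p - q))).
  apply: uniq_leq_size => [|m'].
    rewrite /= msupp_uniq mcoeff_msupp negbK mcoeffB qE mcoeff_mselect.
    by rewrite eqxx subrr andbT.
  rewrite inE => /orP[/eqP->//|]; rewrite !mcoeff_msupp.
  apply: contraNneq => pm'.
  by rewrite mcoeffB qE mcoeff_mselect pm' if_same subrr.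
rewrite qE mselect_comp; have [<-|wc] := eqVneq (weight w m) c.
  rewrite (mselect_eq (Q := fun m' => weight w m' == weight w m)) -?qE //.
  by move=> m' _ /=; rewrite andbb.
rewrite mselect_none; first exact: ideal0.
by move=> m' _ /=; apply: contraNN wc => /andP[/eqP <- /eqP ->].
Qed.

Lemma weightD (a : R) (u v : {ffun E -> R^o}) m :
  weight (a *: u + v) m = a * weight u m + weight v m.
Proof.
rewrite /weight mulr_sumr -big_split; apply: eq_bigr => i _ /=.
by rewrite !ffunE mulrnDl mulrnAr.
Qed.

Lemma weight_homogeneous0 (I : ideal S) :
  weight_homogeneous (0 : {ffun E -> R^o}) I.
Proof.
move=> c p Ip.
have w0 m : weight (0 : {ffun E -> R^o}) m = 0.
  by rewrite /weight big1 // => i _; rewrite ffunE mul0rn.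
have [c0|c0] := eqVneq 0 c.
  by rewrite mselect_id // => m _; rewrite w0 c0.
by rewrite mselect_none => [|m _]; rewrite ?w0 //; apply: ideal0.
Qed.

Lemma weight_homogeneousD (I : ideal S) (a : R) (u v : {ffun E -> R^o}) :
  weight_homogeneous u I -> weight_homogeneous v I ->
  weight_homogeneous (a *: u + v) I.
Proof.
move=> hu hv c p Ip; rewrite (mselect_partition (weight u) p) mselect_sum.
apply: ideal_sum => s _; set ps := mselect _ p.
rewrite (mselect_partition (weight v) ps) mselect_sum.
apply: ideal_sum => t _; set pst := mselect _ ps.
have Ipst : I pst by apply: hv; apply: hu.
have wE m : m \in msupp pst -> weight (a *: u + v) m = a * s + t.
  by rewrite !msupp_mselect weightD => /andP[/eqP-> /andP[/eqP->]].
have [ec|nc] := eqVneq (a * s + t) c.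
  by rewrite mselect_id // => m /wE->; rewrite ec.
by rewrite mselect_none => [|m /wE->//]; apply: ideal0.
Qed.

Lemma lineality_subspace (I : ideal S) :
  exists L : {vspace {ffun E -> R^o}}, forall w, w \in L <-> lineality_set I w.
Proof.
apply: vspace_of_closed => [|a u v /lineality_setP hu /lineality_setP hv].
  exact/lineality_setP/weight_homogeneous0.
exact/lineality_setP/weight_homogeneousD.
Qed.

Definition lineality (I : ideal S) : {vspace {ffun E -> R^o}} :=
  sval (cid (lineality_subspace I)).

Lemma linealityP (I : ideal S) w : w \in lineality I <-> lineality_set I w.
Proof. exact: (svalP (cid (lineality_subspace I))). Qed.

Definition lineality_dual (I : ideal S) : vectType R :=
  'Hom(subvs_of (lineality I), R^o).

Definition coordinate (L : {vspace {ffun E -> R^o}}) (e : E)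
  (v : subvs_of L) : R^o := vsval v e.

Lemma coordinate_is_linear L e : linear (@coordinate L e).
Proof. by move=> a u v; rewrite /coordinate !linearP !ffunE. Qed.

HB.instance Definition _ L e := GRing.isLinear.Build R (subvs_of L) R^o _
  (@coordinate L e) (@coordinate_is_linear L e).

Definition vector_config (I : ideal S) (e : E) : lineality_dual I :=
  linfun (@coordinate (lineality I) e).

Definition minimizers (u : E -> R) : {set E} :=
  [set e | [forall e', u e <= u e']].

(* A cell (a_e)_{e \in E_f} is represented by its set of labels E_f. *)
Definition subd (V : vectType R) (w : E -> R) (a : E -> V) (Delta : {set E}) :=
  exists f : 'Hom(V, R^o), Delta = minimizers (fun e => f (a e) + w e).

Definition rho (Delta : {set E}) (p : S) : S :=
  p \mPo [tuple if enum_val i \in Delta then 'X_i else 0 | i < #|E|].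

Lemma rhoB Delta : {morph rho Delta : p q / p - q}.
Proof. exact: rmorphB. Qed.

Lemma rhoM Delta : {morph rho Delta : p q / p * q}.
Proof. exact: rmorphM. Qed.

Lemma rho1 Delta : rho Delta 1 = 1.
Proof. exact: rmorph1. Qed.

Definition mono_in (Delta : {set E}) (m : M) : bool :=
  [forall i : 'I_#|E|, (m i != 0%N) ==> (enum_val i \in Delta)].

Lemma rhoE Delta p : rho Delta p = mselect (mono_in Delta) p.
Proof.
rewrite /rho comp_mpolyEX /mselect [RHS]big_mkcond.
apply: eq_bigr => m _; rewrite comp_mpolyX.
case: ifPn => [/forallP mD|].
  congr (_ *: _); rewrite [RHS]mpolyXE_id; apply: eq_bigr => i _.
  rewrite tnth_mktuple; have /implyP := mD i; case: ifP => // _ mi.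
  by have /eqP -> : m i == 0%N by apply: contraT => /mi.
case/forallPn => i; rewrite negb_imply => /andP[mi iD].
rewrite (bigD1 i) //= tnth_mktuple (negPf iD) expr0n (negPf mi) mul0r.
by rewrite scaler0.
Qed.

Lemma ones_lineality (I : ideal S) :
  homogeneous_ideal I -> [ffun=> 1] \in lineality I.
Proof.
move=> hI; apply/linealityP/lineality_setP => c p Ip.
have wE m : weight ([ffun=> 1] : {ffun E -> R^o}) m = (mdeg m)%:R.
  rewrite /weight mdegE natr_sum; apply: eq_bigr => i _.
  by rewrite ffunE.
have [/hasP[m _ /eqP mc]|/hasPn pc] :=
  boolP (has (fun m => weight ([ffun=> 1] : {ffun E -> R^o}) m == c) (msupp p)).
  rewrite (mselect_eq (Q := fun m' => mdeg m' == mdeg m)).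
    by rewrite /mselect -pihomogE; apply: hI.
  by move=> m' _ /=; rewrite -mc !wE eqr_nat.
by rewrite mselect_none //; apply: ideal0.
Qed.

Lemma minimizersP (u : E -> R) e :
  reflect (forall e', u e <= u e') (e \in minimizers u).
Proof. by rewrite inE; apply: forallP. Qed.

Lemma minimizers_nonempty (u : E -> R) (e : E) : exists e0, e0 \in minimizers u.
Proof.
case: (@Order.TotalTheory.arg_minP _ _ _ e xpredT u isT) => e0 _ e0min.
by exists e0; apply/minimizersP => e'; apply: e0min.
Qed.

Lemma rhoS (I : ideal S) (w : E -> R) (Delta Gamma : {set E}) p :
  homogeneous_ideal I ->
  subd w (vector_config I) Delta -> subd w (vector_config I) Gamma ->
  Delta \subset Gamma -> I p -> exists2 q, I q & rho Delta p = rho Gamma q.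
Proof.
move=> hI [f fD] [g gG] DG Ip.
have [e _|E0] := pickP E; last first.
  have -> : Delta = Gamma by apply/setP => e; have := E0 e.
  by exists p.
have [e0] := minimizers_nonempty (fun e => f (vector_config I e) + w e) e.
rewrite -fD => e0D.
have [h hE] := bidual_eval (f - g).
have hfg e' : vsval h e' = f (vector_config I e') - g (vector_config I e').
  have := hE (vector_config I e'); rewrite add_lfunE opp_lfunE => ->.
  by rewrite /vector_config lfunE.
pose v : {ffun E -> R^o} := - vsval h e0 *: [ffun=> 1] + vsval h.
have vL : v \in lineality I.
  by rewrite rpredD ?rpredZ ?ones_lineality // subvsP.
have vE e' : v e' = vsval h e' - vsval h e0.
  by rewrite !ffunE /GRing.scale /= mulr1 addrC.
have v_ge0 e' : e' \in Gamma -> 0 <= v e'.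
  move=> e'G; have := subsetP DG _ e0D.
  move: e'G e0D; rewrite vE !hfg fD gG => /minimizersP/(_ e0) le1.
  move=> /minimizersP/(_ e') le2 /minimizersP/(_ e') le3.
  by lra.
have v_eq0 e' : e' \in Gamma -> (v e' == 0) = (e' \in Delta).
  move=> e'G; have := subsetP DG _ e0D.
  move: (e'G) (e0D); rewrite vE !hfg fD gG => /minimizersP/(_ e0) le1.
  move=> /minimizersP le2 /minimizersP/(_ e') le3.
  apply/eqP/minimizersP => [e0'|/(_ e0) le4].
    by move=> e1; have := le2 e1; lra.
  by have := le2 e'; lra.
exists (mselect (fun m => weight v m == 0) p).
  by have /linealityP/lineality_setP := vL; apply.
rewrite !rhoE mselect_comp; apply: mselect_eq => m _ /=.
apply/forallP/andP => [mD|[/forallP mG wm] i].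
  have mG (i : 'I_#|E|) : m i != 0%N -> enum_val i \in Delta by apply/implyP/mD.
  split; first by apply/forallP => i; apply/implyP => /mG; apply: subsetP.
  rewrite /weight big1 // => i _; have [->|/mG iD] := eqVneq (m i) 0%N.
    by rewrite mulr0n.
  have /eqP-> : v (enum_val i) == 0 by rewrite v_eq0 // (subsetP DG).
  by rewrite mul0rn.
apply/implyP => mi.
have iG : enum_val i \in Gamma by have /implyP := mG i; apply.
rewrite -v_eq0 //; move: wm; rewrite /weight psumr_eq0.
  move=> /allP/(_ i (mem_index_enum _)) /=; rewrite mulrn_eq0.
  by rewrite (negPf mi).
move=> j _; have [->|mj] := eqVneq (m j) 0%N; first by rewrite mulr0n.
by apply: mulrn_wge0; apply: v_ge0; have /implyP := mG j; apply.
Qed.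

Definition poly_in (Delta : {set E}) (p : S) : bool :=
  all (mono_in Delta) (msupp p).

Lemma poly_inP Delta p : reflect (rho Delta p = p) (poly_in Delta p).
Proof.
rewrite rhoE; apply: (iffP allP) => [pD|<- m]; first by rewrite mselect_id.
by rewrite msupp_mselect => /andP[].
Qed.

Lemma poly_inB Delta p q :
  poly_in Delta p -> poly_in Delta q -> poly_in Delta (p - q).
Proof.
by move=> /poly_inP pD /poly_inP qD; apply/poly_inP; rewrite rhoB pD qD.
Qed.

Lemma poly_inM Delta p q :
  poly_in Delta p -> poly_in Delta q -> poly_in Delta (p * q).
Proof.
by move=> /poly_inP pD /poly_inP qD; apply/poly_inP; rewrite rhoM pD qD.
Qed.

Lemma poly_inX Delta m : poly_in Delta 'X_[m] = mono_in Delta m.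
Proof. by rewrite /poly_in msuppX /= andbT. Qed.

Lemma poly_in1 Delta : poly_in Delta 1.
Proof. by apply/poly_inP; rewrite rho1. Qed.

Lemma poly_in_rho Delta p : poly_in Delta (rho Delta p).
Proof. by apply/allP => m; rewrite rhoE msupp_mselect => /andP[]. Qed.

Lemma mono_inD Delta m1 m2 :
  mono_in Delta m1 -> mono_in Delta m2 -> mono_in Delta (m1 + m2)%MM.
Proof. by rewrite -!poly_inX mpolyXD; apply: poly_inM. Qed.

Lemma mono_in0 Delta : mono_in Delta 0%MM.
Proof. by rewrite -poly_inX mpolyX0 poly_in1. Qed.

Lemma mono_inS (Delta Gamma : {set E}) m :
  Delta \subset Gamma -> mono_in Delta m -> mono_in Gamma m.
Proof.
move=> DG /forallP mD; apply/forallP => i; apply/implyP => mi.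
by apply: (subsetP DG); have /implyP := mD i; apply.
Qed.

Lemma poly_inS (Delta Gamma : {set E}) p :
  Delta \subset Gamma -> poly_in Delta p -> poly_in Gamma p.
Proof. by move=> DG; apply: sub_all => m; apply: mono_inS. Qed.

(* C[Delta]^o is realized inside the fraction field of S, as the set of
   quotients of a polynomial by a monomial in the variables of Delta. *)
Definition laurent_set (Delta : {set E}) (z : {fraction S}) : Prop :=
  exists p m, [/\ poly_in Delta p, mono_in Delta m &
    z = tofrac p / tofrac 'X_[m]].

Definition laurent_degree_set (Delta : {set E}) (d : int)
    (z : {fraction S}) : Prop :=
  exists p m k, [/\ poly_in Delta p, mono_in Delta m, p \is k.-homog,
    d = k%:Z - (mdeg m)%:Z & z = tofrac p / tofrac 'X_[m]].

Lemma tofracX_neq0 (m : M) : tofrac ('X_[m] : S) != 0.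
Proof. by rewrite tofrac_eq0 -msupp_eq0 msuppX. Qed.

Lemma tofrac_divB (p q : S) (m1 m2 : M) :
  tofrac p / tofrac 'X_[m1] - tofrac q / tofrac 'X_[m2] =
  tofrac (p * 'X_[m2] - q * 'X_[m1]) / tofrac 'X_[(m1 + m2)%MM].
Proof.
rewrite -mulNr addf_div ?tofracX_neq0 // mpolyXD tofracB !tofracM.
by rewrite mulNr.
Qed.

Lemma tofrac_divM (p q : S) (m1 m2 : M) :
  (tofrac p / tofrac 'X_[m1]) * (tofrac q / tofrac 'X_[m2]) =
  tofrac (p * q) / tofrac 'X_[(m1 + m2)%MM].
Proof. by rewrite mulf_div mpolyXD !tofracM. Qed.

Lemma laurent_tofrac Delta p : poly_in Delta p -> laurent_set Delta (tofrac p).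
Proof.
move=> pD; exists p, 0%MM; split=> //; first exact: mono_in0.
by rewrite mpolyX0 tofrac1 divr1.
Qed.

Lemma laurent1 Delta : laurent_set Delta 1.
Proof. by rewrite -tofrac1; apply: laurent_tofrac; apply: poly_in1. Qed.

Lemma laurentB Delta x y :
  laurent_set Delta x -> laurent_set Delta y -> laurent_set Delta (x - y).
Proof.
move=> [p [m [pD mD ->]]] [q [m' [qD m'D ->]]]; rewrite tofrac_divB.
exists (p * 'X_[m'] - q * 'X_[m]), (m + m')%MM; split=> //.
  by apply: poly_inB; apply: poly_inM; rewrite ?poly_inX.
exact: mono_inD.
Qed.

Lemma laurentM Delta x y :
  laurent_set Delta x -> laurent_set Delta y -> laurent_set Delta (x * y).
Proof.
move=> [p [m [pD mD ->]]] [q [m' [qD m'D ->]]]; rewrite tofrac_divM.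
exists (p * q), (m + m')%MM; split=> //; first exact: poly_inM.
exact: mono_inD.
Qed.

Definition laurent_subring (Delta : {set E}) : subring {fraction S} :=
  Subring (laurent1 Delta) (@laurentB Delta) (@laurentM Delta).

Definition laurent (Delta : {set E}) : comPzRingType :=
  subring_type (laurent_subring Delta).

Definition laurent_degree (Delta : {set E}) (d : int) (z : laurent Delta) :=
  laurent_degree_set Delta d (sval z).

Lemma laurent_degree1 Delta : laurent_degree 0 (1 : laurent Delta).
Proof.
exists 1, 0%MM, 0%N; split; rewrite ?poly_in1 ?mono_in0 ?mdeg0 ?subrr //.
  exact: dhomog1.
by rewrite mpolyX0 tofrac1 divr1.
Qed.

Lemma laurent_degreeB Delta d (x y : laurent Delta) :
  laurent_degree d x -> laurent_degree d y -> laurent_degree d (x - y).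
Proof.
move=> [p [m [k [pD mD pk dk xE]]]] [q [m' [k' [qD m'D qk' dk' yE]]]].
exists (p * 'X_[m'] - q * 'X_[m]), (m + m')%MM, (k + mdeg m')%N; split.
- by apply: poly_inB; apply: poly_inM; rewrite ?poly_inX.
- exact: mono_inD.
- apply: rpredB; first by apply: dhomogM => //; rewrite dhomogX.
  have -> : (k + mdeg m' = k' + mdeg m)%N by lia.
  by apply: dhomogM => //; rewrite dhomogX.
- by rewrite mdegD; lia.
- by rewrite -[LHS]/(val (x - y)) rmorphB /= xE yE tofrac_divB.
Qed.

Lemma laurent_degreeM Delta d e (x y : laurent Delta) :
  laurent_degree d x -> laurent_degree e y -> laurent_degree (d + e) (x * y).
Proof.
move=> [p [m [k [pD mD pk dk xE]]]] [q [m' [k' [qD m'D qk' ek' yE]]]].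
exists (p * q), (m + m')%MM, (k + k')%N; split.
- exact: poly_inM.
- exact: mono_inD.
- exact: dhomogM.
- by rewrite mdegD; lia.
- by rewrite -[LHS]/(val (x * y)) rmorphM /= xE yE tofrac_divM.
Qed.

(* The degree-0 part of the graded ring C[Delta]^o / J, for J homogeneous. *)
Definition degree0_set Delta (J : ideal (laurent Delta)) (u : quot J) : Prop :=
  exists2 z : laurent Delta, laurent_degree 0 z & u = quot_pi J z.

Lemma degree0_1 Delta (J : ideal (laurent Delta)) : degree0_set (1 : quot J).
Proof. by exists 1; [apply: laurent_degree1|rewrite rmorph1]. Qed.

Lemma degree0_B Delta (J : ideal (laurent Delta)) (u v : quot J) :
  degree0_set u -> degree0_set v -> degree0_set (u - v).
Proof.
move=> [x x0 ->] [y y0 ->]; exists (x - y); last by rewrite rmorphB.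
exact: laurent_degreeB.
Qed.

Lemma degree0_M Delta (J : ideal (laurent Delta)) (u v : quot J) :
  degree0_set u -> degree0_set v -> degree0_set (u * v).
Proof.
move=> [x x0 ->] [y y0 ->]; exists (x * y); last by rewrite rmorphM.
by rewrite -[0]addr0; apply: laurent_degreeM.
Qed.

Definition degree0_subring Delta (J : ideal (laurent Delta)) :
    subring (quot J) :=
  Subring (degree0_1 J) (@degree0_B Delta J) (@degree0_M Delta J).

Definition degree0_quot Delta (J : ideal (laurent Delta)) : comPzRingType :=
  subring_type (degree0_subring J).

Section Inclusion.
Variables (Delta Gamma : {set E}).
Hypothesis DG : Delta \subset Gamma.

Lemma laurentS z : laurent_set Delta z -> laurent_set Gamma z.
Proof.
move=> [p [m [pD mD zE]]]; exists p, m; split=> //; first exact: poly_inS pD.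
exact: mono_inS mD.
Qed.

Definition laurent_incl : {rmorphism laurent Delta -> laurent Gamma} :=
  subring_map (P := laurent_subring Delta) (Q := laurent_subring Gamma)
    (f := idfun) laurentS.

Lemma laurent_degreeS d z :
  laurent_degree d z -> laurent_degree d (laurent_incl z).
Proof.
move=> [p [m [k [pD mD pk dk zE]]]]; exists p, m, k; split=> //.
  exact: poly_inS pD.
exact: mono_inS mD.
Qed.

Variables (J : ideal (laurent Delta)) (K : ideal (laurent Gamma)).
Hypothesis JK : forall z, J z -> K (laurent_incl z).

Lemma degree0_quotS (u : quot J) :
  degree0_set u -> degree0_set (quot_map JK u).
Proof.
move=> [z z0 ->]; exists (laurent_incl z); last exact: quot_mapE.
exact: laurent_degreeS.
Qed.

Definition degree0_quot_incl : {rmorphism degree0_quot J -> degree0_quot K} :=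
  subring_map (P := degree0_subring J) (Q := degree0_subring K)
    (f := quot_map JK) degree0_quotS.

Lemma degree0_quot_inclE (u : degree0_quot J) z :
  sval u = quot_pi J z ->
  sval (degree0_quot_incl u) = quot_pi K (laurent_incl z).
Proof. by move=> /= ->; apply: quot_mapE. Qed.

End Inclusion.

Section Schemes.
Variables (I : ideal S) (w : E -> R).

Definition Theta (Delta : {set E}) : Prop := subd w (vector_config I) Delta.

(* rho_Delta(I) C[Delta]^o *)
Definition cell_ideal (Delta : {set E}) : ideal (laurent Delta) :=
  ideal_gen (fun z : laurent Delta =>
    exists2 p, I p & sval z = tofrac (rho Delta p)).

Definition R_cell (Delta : {set E}) : comPzRingType :=
  degree0_quot (cell_ideal Delta).

Definition X_cell (Delta : {set E}) : affine_scheme_cat := Spec (R_cell Delta).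

(* I_w^o, in S^o = laurent [set: E] *)
Definition total_ideal : ideal (laurent [set: E]) :=
  ideal_gen (fun z : laurent [set: E] => exists2 Delta, Theta Delta &
    exists2 p, I p & sval z = tofrac (rho Delta p)).

Definition R_total : comPzRingType := degree0_quot total_ideal.

Definition X_total : affine_scheme_cat := Spec R_total.

Definition cell := {Delta : {set E} | `[< Theta Delta >]}.

Lemma cellP (Delta : cell) : Theta (sval Delta).
Proof. by apply/asboolP; case: Delta. Qed.

Program Definition cell_poset : category :=
  @Category cell (fun D G => sval D \subset sval G)
    (fun D => subxx (sval D)) (fun D G H gh dg => subset_trans dg gh) _ _ _.
Next Obligation. by move=> *; apply: eq_irrelevance. Qed.
Next Obligation. by move=> *; apply: eq_irrelevance. Qed.
Next Obligation. by move=> *; apply: eq_irrelevance. Qed.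

Hypothesis hI : homogeneous_ideal I.

Lemma cell_idealS (Delta Gamma : cell)
    (DG : sval Delta \subset sval Gamma) (z : laurent (sval Delta)) :
  cell_ideal (sval Delta) z -> cell_ideal (sval Gamma) (laurent_incl DG z).
Proof.
apply: ideal_gen_map => {}z [p Ip zE]; apply: ideal_gen_sub.
have [q Iq pq] := rhoS hI (cellP Delta) (cellP Gamma) DG Ip.
exists q; first exact: Iq.
rewrite -pq -zE; reflexivity.
Qed.

Lemma total_idealS (Delta : cell) (z : laurent (sval Delta)) :
  cell_ideal (sval Delta) z -> total_ideal (laurent_incl (finset.subsetT _) z).
Proof.
apply: ideal_gen_map => {}z [p Ip zE]; apply: ideal_gen_sub.
exists (sval Delta); first exact: cellP.
exists p; first exact: Ip.
rewrite -zE; reflexivity.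
Qed.

Definition X_map (Delta Gamma : cell) (DG : sval Delta \subset sval Gamma) :
    hom (X_cell (sval Gamma)) (X_cell (sval Delta)) :=
  Spec_map (degree0_quot_incl (cell_idealS DG)).

Program Definition X_diagram :
    functor (opposite cell_poset) affine_scheme_cat :=
  @Functor (opposite cell_poset) affine_scheme_cat
    (fun Delta => X_cell (sval Delta)) (fun G D DG => X_map DG) _ _.
Next Obligation.
move=> Delta; apply: Spec_map1 => u; apply: val_inj.
have [z _ uz] := subring_typeP u.
rewrite [LHS](degree0_quot_inclE _ uz) [RHS]uz; congr quot_pi; exact: val_inj.
Qed.
Next Obligation.
move=> H Gamma Delta DG GH; apply: Spec_mapM => u; apply: val_inj.
have [z _ uz] := subring_typeP u.
rewrite [LHS](degree0_quot_inclE _ uz).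
rewrite [RHS](degree0_quot_inclE _ (degree0_quot_inclE _ uz)).
by congr quot_pi; apply: val_inj.
Qed.

Program Definition X_cone : cone X_diagram X_total :=
  @Cone _ _ X_diagram X_total
    (fun Delta => Spec_map (degree0_quot_incl (@total_idealS Delta))) _.
Next Obligation.
move=> Gamma Delta DG; apply/esym; apply: Spec_mapM => u; apply: val_inj.
have [z _ uz] := subring_typeP u.
rewrite [LHS](degree0_quot_inclE _ uz).
rewrite [RHS](degree0_quot_inclE _ (degree0_quot_inclE _ uz)).
by congr quot_pi; apply: val_inj.
Qed.

End Schemes.

End Degeneration.

(* Main.v *)
(* By the Yoneda lemma it suffices that R_w is the colimit of the rings
   R_Delta.  The degree-0 Laurent polynomials on Delta are generated by the
   constants and the ratios x_e / x_e' with e, e' in Delta, so compatible maps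
   phi_Delta : R_Delta -> B give units phi(x_e / x_e') of B for all e, e' lying
   in a common cell, which form a cocycle.  The map on R_w exists and is unique
   once this cocycle is P_e / P_e' for some units P_e of B.  The labels e
   correspond to the closed convex sets N_e = {f | e minimizes f(a_e) + w_e},
   which cover the space of all f, so the claim is that the nerve of this cover
   is connected with vanishing H^1: both statements hold on convex sets on
   which some e is minimal throughout, and they glue along a hyperplane
   u_a = u_b, where u_e(f) = f(a_e) + w_e. *)

Require Import Defs.
From HB Require Import structures.
From mathcomp Require Import all_boot all_order all_algebra.
From mathcomp Require Import boolp reals complex.
From mathcomp Require Import zify lra ring.
From mathcomp.multinomials Require Import mpoly.

Set Implicit Arguments.
Unset Strict Implicit.
Unset Printing Implicit Defensive.

Import Order.TTheory GRing.Theory Num.Theory.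
Local Open Scope ring_scope.

(** * Covers of convex sets by the minimality loci of affine functions *)

Section AffineCover.
Variables (R : realType) (E : finType) (V : lmodType R) (u : E -> V -> R).
Hypothesis u_affine : forall e (t : R) x y,
  u e ((1 - t) *: x + t *: y) = (1 - t) * u e x + t * u e y.
Local Notation argmin x := (minimizers (fun e => u e x)).

Definition convex_set (Q : V -> Prop) : Prop :=
  forall (t : R) x y, 0 <= t -> t <= 1 -> Q x -> Q y ->
    Q ((1 - t) *: x + t *: y).

Definition met (Q : V -> Prop) (e : E) : Prop :=
  exists2 x, Q x & e \in argmin x.

Definition cut (Q : V -> Prop) (a b : E) (x : V) : Prop :=
  Q x /\ u a x <= u b x.

(** The common minimizer [e] makes the minimum at the midpoint the average of the two minima, so a
    label attains it there only by being minimal at both ends. Hence two cells that share a label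
    intersect in a cell. *)
Lemma argmin_midpoint x y e : e \in argmin x -> e \in argmin y ->
  argmin ((1 - 2^-1) *: x + 2^-1 *: y) = argmin x :&: argmin y.
Proof.
move=> /minimizersP ex /minimizersP ey; apply/setP => a; rewrite in_setI.
apply/minimizersP/andP => [az|[/minimizersP ax /minimizersP ay] b].
  have := az e; rewrite !u_affine => aez.
  have := ex a; have := ey a => eya exa.
  split; apply/minimizersP => b; [have := ex b|have := ey b]; lra.
by rewrite !u_affine; have := ax b; have := ay b; lra.
Qed.

Lemma convex_argmin (Q : V -> Prop) e :
  convex_set Q -> convex_set (fun x => Q x /\ e \in argmin x).
Proof.
move=> cQ t x y t0 t1 [Qx /minimizersP ex] [Qy /minimizersP ey].
split; first exact: cQ.
apply/minimizersP => b; rewrite !u_affine.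
by apply: lerD; apply: ler_wpM2l; rewrite ?subr_ge0.
Qed.

Lemma convex_cut Q a b : convex_set Q -> convex_set (cut Q a b).
Proof.
move=> cQ t x y t0 t1 [Qx x_ab] [Qy y_ab]; split; first exact: cQ.
rewrite !u_affine.
by apply: lerD; apply: ler_wpM2l; rewrite ?subr_ge0.
Qed.

(** Intermediate value theorem for the affine function [u b - u a] on the segment from [x] to
    [y]. *)
Lemma convex_crossing Q a b x y : convex_set Q -> Q x -> Q y ->
  u a x <= u b x -> u b y <= u a y -> exists2 z, Q z & u a z = u b z.
Proof.
move=> cQ Qx Qy x_ab y_ba.
set p := u b x - u a x; set q := u a y - u b y.
have p0 : 0 <= p by rewrite subr_ge0.
have q0 : 0 <= q by rewrite subr_ge0.
have [pq0|pq_neq0] := eqVneq (p + q) 0.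
  by exists x => //; rewrite /p /q in p0 q0 pq0; lra.
have pq_gt0 : 0 < p + q by rewrite lt_def pq_neq0 addr_ge0.
(* The difference [u b - u a] runs from [p] at [x] to [- q] at [y], so it vanishes at parameter
   [p / (p + q)]. *)
exists ((1 - p / (p + q)) *: x + (p / (p + q)) *: y).
  apply: cQ => //; first by rewrite divr_ge0 // addr_ge0.
  by rewrite ler_pdivrMr // mul1r lerDl.
rewrite !u_affine -[u a y](subrK (u b y)) -/q -[u b x](subrK (u a x)) -/p.
by field.
Qed.

(* Cutting along all the hyperplanes u_a = u_b leaves convex pieces on which
   the u_e are totally ordered, hence one of them is everywhere minimal. *)
Lemma convex_cut_ind (e0 : E) (T : (V -> Prop) -> Prop) :
  (forall Q e, convex_set Q -> (forall x, Q x -> e \in argmin x) -> T Q) ->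
  (forall Q a b, convex_set Q -> T (cut Q a b) -> T (cut Q b a) -> T Q) ->
  forall Q, convex_set Q -> T Q.
Proof.
move=> Tmin Tcut.
pose le Q a b := forall x : V, Q x -> u a x <= u b x.
(* The list [l] holds the pairs whose order on [Q] may still vary; cutting along its head decides
   that pair on both halves. *)
suff H (l : seq (E * E)) Q : convex_set Q ->
    (forall a b, (a, b) \notin l -> le Q a b \/ le Q b a) -> T Q.
  move=> Q cQ; apply: (H (enum {: E * E}) Q cQ) => a b.
  by rewrite mem_enum inE.
elim: l Q => [|[a b] l IH] Q cQ Ql.
  have leT a b : le Q a b \/ le Q b a by apply: Ql.
  have [e [_ emin]] : exists e, e \in e0 :: enum E /\
      forall e', e' \in e0 :: enum E -> le Q e e'.
    elim: (enum E) => [|a s [e [es emin]]].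
      by exists e0; rewrite mem_head; split=> // e'; rewrite inE => /eqP-> x.
    have [ae|ea] := leT a e.
      exists a; rewrite !inE eqxx orbT; split=> // e'.
      rewrite !inE orbCA => /orP[/eqP->//|e's] x Qx.
      by apply: (le_trans (ae x Qx)); apply: emin; rewrite ?inE.
    exists e; split; first by rewrite !inE orbCA -in_cons es orbT.
    by move=> e'; rewrite !inE orbCA => /orP[/eqP->//|e's]; apply: emin.
  apply: (Tmin Q e cQ) => x Qx; apply/minimizersP => e'.
  by apply: emin Qx; rewrite inE mem_enum orbT.
apply: (Tcut Q a b cQ); apply: IH; try exact: convex_cut.
- move=> c d cdl; have [[-> ->]|cd] := eqVneq (c, d) (a, b).
    by left=> x [].
  by have [|h|h] := Ql c d; [rewrite inE negb_or cd|left|right] => // x [/h].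
- move=> c d cdl; have [[-> ->]|cd] := eqVneq (c, d) (a, b).
    by right=> x [].
  by have [|h|h] := Ql c d; [rewrite inE negb_or cd|left|right] => // x [/h].
Qed.

(** The locus in [Q] where [e] is minimal is convex, so it crosses the wall [u a = u b] once it
    meets both sides. *)
Lemma met_cut Q a b e : convex_set Q -> met (cut Q a b) e ->
  met (cut Q b a) e -> met (cut (cut Q a b) b a) e.
Proof.
move=> cQ [x [Qx xab] ex] [y [Qy yba] ey].
have [z [Qz ez] zab] :=
  convex_crossing (convex_argmin (e := e) cQ) (conj Qx ex) (conj Qy ey) xab yba.
by exists z => //; split; [split=> //; rewrite zab|rewrite zab].
Qed.

Lemma cut_cases Q a b x : Q x -> cut Q a b x \/ cut Q b a x.
Proof. by move=> Qx; case: (lerP (u a x) (u b x)) => [|/ltW]; [left|right]. Qed.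

Lemma cuts_meet Q a b (e0 : E) x y : convex_set Q ->
  cut Q a b x -> cut Q b a y -> exists e, met (cut (cut Q a b) b a) e.
Proof.
move=> cQ [Qx xab] [Qy yba].
have [z Qz zab] := convex_crossing cQ Qx Qy xab yba.
have [e ez] := minimizers_nonempty (fun e => u e z) e0.
by exists e, z => //; split; [split=> //; rewrite zab|rewrite zab].
Qed.

(** If one label is minimal throughout [Q], it shares a point with every label met. Otherwise the
    two halves of a cut are linked by a label that is minimal somewhere on the wall. *)
Lemma cover_connected (T : Type) (q : E -> T) Q : convex_set Q ->
  (forall x e e', Q x -> e \in argmin x -> e' \in argmin x -> q e = q e') ->
  forall e e', met Q e -> met Q e' -> q e = q e'.
Proof.
move=> cQ Qq e e'; move: Q cQ Qq e e'.
suff H (e0 : E) Q : convex_set Q ->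
    (forall x e e', Q x -> e \in argmin x -> e' \in argmin x -> q e = q e') ->
    forall e e', met Q e -> met Q e' -> q e = q e'.
  by move=> Q cQ Qq e e'; apply: (H e Q cQ Qq).
move=> cQ; move: Q cQ.
apply: (convex_cut_ind e0) => [Q a _ Qa Qq e e'|Q a b cQ].
  move=> [x Qx ex] [y Qy e'y].
  by rewrite (Qq x e a) ?(Qq y a e') //; apply: Qa.
move=> H1 H2 Qq.
have {}H1 : forall e e', met (cut Q a b) e -> met (cut Q a b) e' -> q e = q e'.
  by apply: H1 => x e e' [Qx _]; apply: Qq.
have {}H2 : forall e e', met (cut Q b a) e -> met (cut Q b a) e' -> q e = q e'.
  by apply: H2 => x e e' [Qx _]; apply: Qq.
have H e e' : met (cut Q a b) e -> met (cut Q b a) e' -> q e = q e'.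
  move=> m1 m2; have [x x1 _] := m1; have [y y2 _] := m2.
  have [e1 [z [[Qz zab] zba] e1z]] := cuts_meet e0 cQ x1 y2.
  rewrite (H1 e e1) //; last by exists z.
  by apply: H2 => //; exists z.
have metU e : met Q e -> met (cut Q a b) e \/ met (cut Q b a) e.
  by move=> [x Qx ex]; case: (cut_cases a b Qx); [left|right]; exists x.
move=> e e' /metU[m1|m2] /metU[m1'|m2']; [exact: H1|exact: H| |exact: H2].
by rewrite (H e' e).
Qed.

(** A Mayer-Vietoris argument: trivializations on the two halves of a cut differ on the wall by a
    factor that is constant by [cover_connected], and rescaling one of them by it glues them. [P']
    records the inverses of [P]. *)
Lemma cocycle_trivial (B : comPzRingType) (c : E -> E -> B) Q : convex_set Q ->
  (forall e, c e e = 1) ->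
  (forall x e1 e2 e3, Q x -> e1 \in argmin x -> e2 \in argmin x ->
    e3 \in argmin x -> c e1 e2 * c e2 e3 = c e1 e3) ->
  exists P P' : E -> B, (forall e, P e * P' e = 1) /\
    forall x e e', Q x -> e \in argmin x -> e' \in argmin x ->
      c e e' = P e * P' e'.
Proof.
have [e0 _|E0] := pickP E; last first.
  move=> _ _ _; exists (fun _ => 1), (fun _ => 1).
  by split=> [e|x e]; have := E0 e.
move=> cQ c1; move: Q cQ.
apply: (convex_cut_ind e0) => [Q a _ Qa cM|Q a b cQ IH1 IH2 cM].
  (* As [a] is minimal on all of [Q], the values [c e a] trivialize [c]. The default 1 keeps [P]
     invertible at labels that [Q] does not meet. *)
  pose adj e := `[< exists2 x, Q x & e \in argmin x >].
  exists (fun e => if adj e then c e a else 1).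
  exists (fun e => if adj e then c a e else 1); split=> [e|x e e' Qx ex e'x].
    case: ifP => [/asboolP[x Qx ex]|_]; last by rewrite mulr1.
    by rewrite (cM x) ?c1 //; apply: Qa.
  have -> : adj e by apply/asboolP; exists x.
  have -> : adj e' by apply/asboolP; exists x.
  by rewrite (cM x) //; apply: Qa.
have [P1 [P1' [P1V P1E]]] : exists P P' : E -> B, (forall e, P e * P' e = 1) /\
    forall x e e', cut Q a b x -> e \in argmin x -> e' \in argmin x ->
      c e e' = P e * P' e'.
  by apply: IH1 => x e1 e2 e3 [Qx _]; apply: cM.
have [P2 [P2' [P2V P2E]]] : exists P P' : E -> B, (forall e, P e * P' e = 1) /\
    forall x e e', cut Q b a x -> e \in argmin x -> e' \in argmin x ->
      c e e' = P e * P' e'.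
  by apply: IH2 => x e1 e2 e3 [Qx _]; apply: cM.
have [[x1 Q1x1]|Q1_empty] := EM (exists x, cut Q a b x); last first.
  exists P2, P2'; split=> // x e e' Qx; apply: P2E.
  by case: (cut_cases a b Qx) => // Q1x; case: Q1_empty; exists x.
have [[x2 Q2x2]|Q2_empty] := EM (exists x, cut Q b a x); last first.
  exists P1, P1'; split=> // x e e' Qx; apply: P1E.
  by case: (cut_cases a b Qx) => // Q2x; case: Q2_empty; exists x.
have [e1 e1Q0] := cuts_meet e0 cQ Q1x1 Q2x2.
(* [k] is the quotient [P1 / P2] at one label on the wall, and [k'] is its inverse. *)
set k := P1 e1 * P2' e1; set k' := P1' e1 * P2 e1.
have kV : k * k' = 1.
  by rewrite /k /k' mulrACA [_ * P2 _]mulrC P1V P2V mulr1.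
have PP e : met (cut (cut Q a b) b a) e -> P1 e * P2' e = k.
  move=> eQ0; rewrite /k.
  apply: (cover_connected (q := fun e => P1 e * P2' e)
    (convex_cut (a := b) (b := a) (convex_cut (a := a) (b := b) cQ))) => //.
  move=> x e2 e3 [Q1x xba] e2x e3x.
  have h1 := P1E x e2 e3 Q1x e2x e3x.
  have h2 := P2E x e2 e3 (conj Q1x.1 xba) e2x e3x.
  (* Both [P1 e2 * P1' e3] and [P2 e2 * P2' e3] equal [c e2 e3]; factors equal to 1 are inserted
     until one can replace the other. *)
  transitivity (P1 e2 * P2' e2 * (P2 e3 * P2' e3)); first by rewrite P2V mulr1.
  transitivity (P1 e2 * P1' e3 * (P1 e3 * P2' e2 * P2 e3 * P2' e3)).
    transitivity (P1 e2 * P2' e2 * (P2 e3 * P2' e3) * (P1 e3 * P1' e3)).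
      by rewrite P1V mulr1.
    by ring.
  rewrite -h1 h2.
  transitivity (P1 e3 * P2' e3 * (P2 e2 * P2' e2) * (P2 e3 * P2' e3)).
    by ring.
  by rewrite !P2V !mulr1.
pose m1 e := `[< met (cut Q a b) e >].
exists (fun e => if m1 e then P1 e else k * P2 e).
exists (fun e => if m1 e then P1' e else k' * P2' e).
(* A label met on both sides is met on the wall, where [P1 = k * P2]; so the rescaled [P2] is valid
   on the whole second half. *)
have P2_eq e : met (cut Q b a) e ->
    ((if m1 e then P1 e else k * P2 e) = k * P2 e) /\
    ((if m1 e then P1' e else k' * P2' e) = k' * P2' e).
  case: ifP => // /asboolP e1m e2m; have ke := PP e (met_cut cQ e1m e2m).
  have P1e : P1 e = k * P2 e by rewrite -ke -mulrA [P2' _ * _]mulrC P2V mulr1.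
  split=> //; transitivity (P1' e * (k * k') * (P2 e * P2' e)).
    by rewrite kV P2V !mulr1.
  transitivity (P1' e * (k * P2 e) * (k' * P2' e)); first by ring.
  by rewrite -P1e [P1' e * _]mulrC P1V mul1r.
split=> [e|x e e' Qx ex e'x].
  by case: ifP => // _; rewrite mulrACA kV P2V mulr1.
case: (cut_cases a b Qx) => Qabx.
  have -> : m1 e by apply/asboolP; exists x.
  have -> : m1 e' by apply/asboolP; exists x.
  exact: P1E Qabx _ _.
have [-> _] : _ /\ _ := P2_eq e (ex_intro2 _ _ x Qabx ex).
have [_ ->] : _ /\ _ := P2_eq e' (ex_intro2 _ _ x Qabx e'x).
by rewrite mulrACA kV mul1r; apply: P2E Qabx _ _.
Qed.

End AffineCover.

(** * Degree-0 Laurent polynomials *)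

Lemma comPzRing_trivial (B : comPzRingType) :
  (1 : B) = 0 -> forall x y : B, x = y.
Proof. by move=> B0 x y; rewrite -[x]mulr1 -[y]mulr1 B0 !mulr0. Qed.

Lemma mpoly_eval_exists (k : comNzRingType) (n : nat) (B : comPzRingType)
    (iota : {rmorphism k -> B}) (P : 'I_n -> B) :
  exists ev : {rmorphism {mpoly k[n]} -> B},
    (forall c, ev c%:MP = iota c) /\ (forall i, ev 'X_i = P i).
Proof.
(* mmap needs a nontrivial target, but B may be the zero ring. *)
have [B0|B1] := eqVneq (1 : B) 0.
  have triv := comPzRing_trivial B0.
  pose f (_ : {mpoly k[n]}) : B := 0.
  have fB : zmod_morphism f by move=> x y; apply: triv.
  have fM : monoid_morphism f by split=> [|x y]; apply: triv.
  pose fzmod := GRing.isZmodMorphism.Build _ _ f fB.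
  pose fmonoid := GRing.isMonoidMorphism.Build _ _ f fM.
  pose ev : {rmorphism {mpoly k[n]} -> B} := HB.pack f fzmod fmonoid.
  by exists ev; split=> *; apply: triv.
pose nz := GRing.PzSemiRing_isNonZero.Build B B1.
pose B' : comNzRingType := HB.pack (GRing.ComPzRing.sort B) nz.
pose iota' : {rmorphism k -> B'} := iota.
pose ev : {rmorphism {mpoly k[n]} -> B'} := mmap iota' (P : 'I_n -> B').
exists ev; split=> [c|i]; first exact: (mmapC (P : 'I_n -> B') iota' c).
rewrite -(mmap1U (P : 'I_n -> B') i).
exact: (mmapX (P : 'I_n -> B') iota' U_(i)%MM).
Qed.

Lemma ideal_gen_kernel (A B : comPzRingType) (f : {rmorphism A -> B})
    (G : A -> Prop) :
  (forall x, G x -> f x = 0) -> forall x, ideal_gen G x -> f x = 0.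
Proof.
move=> fG x Gx; have f0 := rmorph0 f.
have fD y z : f y = 0 -> f z = 0 -> f (y + z) = 0.
  by rewrite rmorphD => -> ->; rewrite addr0.
have fM a y : f y = 0 -> f (a * y) = 0 by rewrite rmorphM => ->; rewrite mulr0.
exact: (Gx (@Ideal A (fun y => f y = 0) f0 fD fM)).
Qed.

Lemma mpoly_no_vars (k : comNzRingType) (n : nat) (p : {mpoly k[n]}) :
  n = 0%N -> p = (p@_(0%MM))%:MP.
Proof.
move=> n0; apply/mpolyP => m; rewrite mcoeffC.
have -> : m = 0%MM by apply/mnmP; rewrite {}n0 in p m * => -[].
by rewrite eqxx mulr1.
Qed.

Lemma quot_lift_exists (A B : comPzRingType) (J : ideal A)
    (f : {rmorphism A -> B}) :
  (forall x, J x -> f x = 0) ->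
  exists g : {rmorphism quot J -> B}, forall x, g (quot_pi J x) = f x.
Proof.
move=> fJ; pose g (x : quot J) := f (generic_quotient.repr x).
have gE x : g (quot_pi J x) = f x.
  apply/eqP; rewrite -subr_eq0 -rmorphB; apply/eqP/fJ.
  exact: quot_reprP.
have gB : zmod_morphism g.
  elim/quot_pi_ind=> x; elim/quot_pi_ind=> y.
  by rewrite -rmorphB !gE rmorphB.
have gM : monoid_morphism g.
  split; first by rewrite -(rmorph1 (quot_pi J)) gE rmorph1.
  elim/quot_pi_ind=> x; elim/quot_pi_ind=> y.
  by rewrite -rmorphM !gE rmorphM.
pose gzmod := GRing.isZmodMorphism.Build _ _ g gB.
pose gmonoid := GRing.isMonoidMorphism.Build _ _ g gM.
by exists (HB.pack_for {rmorphism quot J -> B} g gzmod gmonoid).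
Qed.

Section LaurentDegree0.
Variables (R : realType) (E : finType).
Local Notation C := R[i].
Local Notation S := {mpoly C[#|E|]}.
Local Notation M := 'X_{1..#|E|}.
Local Notation tofrac := (@FracField.tofrac S).

Definition fconst (c : C) : {fraction S} := tofrac c%:MP.

Definition fratio (e e' : E) : {fraction S} :=
  tofrac 'X_(enum_rank e) / tofrac 'X_(enum_rank e').

Lemma laurent_degree_laurent (Delta : {set E}) d z :
  laurent_degree_set Delta d z -> laurent_set (R := R) Delta z.
Proof. by move=> [p [m [k [pD mD _ _ ->]]]]; exists p, m. Qed.

Lemma laurent_valB (Delta : {set E}) (x y : laurent R Delta) :
  sval (x - y) = sval x - sval y.
Proof. by []. Qed.

Lemma laurent_valM (Delta : {set E}) (x y : laurent R Delta) :
  sval (x * y) = sval x * sval y.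
Proof. by []. Qed.

Definition degree0_laurent (Delta : {set E}) z
    (hz : laurent_degree_set (R := R) Delta 0 z) : laurent R Delta :=
  subring_elt (P := laurent_subring R Delta) (laurent_degree_laurent hz).

Lemma degree0_frac1 (Delta : {set E}) :
  laurent_degree_set (R := R) Delta 0 1.
Proof. exact: laurent_degree1. Qed.

Lemma degree0_fracB (Delta : {set E}) x y :
  laurent_degree_set (R := R) Delta 0 x ->
  laurent_degree_set Delta 0 y -> laurent_degree_set Delta 0 (x - y).
Proof.
by move=> hx hy; apply: (@laurent_degreeB _ _ _ _ (degree0_laurent hx)
  (degree0_laurent hy)).
Qed.

Lemma degree0_fracM (Delta : {set E}) x y :
  laurent_degree_set (R := R) Delta 0 x ->
  laurent_degree_set Delta 0 y -> laurent_degree_set Delta 0 (x * y).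
Proof.
move=> hx hy; rewrite -[0]addr0.
exact: (@laurent_degreeM _ _ _ _ _ (degree0_laurent hx) (degree0_laurent hy)).
Qed.

Lemma degree0_fracD (Delta : {set E}) x y :
  laurent_degree_set (R := R) Delta 0 x ->
  laurent_degree_set Delta 0 y -> laurent_degree_set Delta 0 (x + y).
Proof.
move=> hx hy; have h0 := degree0_fracB hy hy.
rewrite -[y]opprK -[- y]add0r -(subrr y).
by apply: degree0_fracB => //; apply: degree0_fracB.
Qed.

Lemma degree0_fconst (Delta : {set E}) c :
  laurent_degree_set Delta 0 (fconst c).
Proof.
exists c%:MP, 0%MM, 0%N; split.
- by rewrite /poly_in msuppC; case: ifP => //= _; rewrite mono_in0.
- exact: mono_in0.
- by rewrite -[c]mulr1 mpolyCM mul_mpolyC dhomogZ // dhomog1.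
- by rewrite mdeg0 subrr.
- by rewrite mpolyX0 rmorph1 divr1.
Qed.

Lemma mono_inU (Delta : {set E}) e :
  e \in Delta -> mono_in Delta U_(enum_rank e).
Proof.
move=> eD; apply/forallP => i; rewrite mnm1E; apply/implyP.
by have [<-|] := eqVneq (enum_rank e) i; rewrite ?enum_rankK.
Qed.

Lemma degree0_fratio (Delta : {set E}) e e' : e \in Delta -> e' \in Delta ->
  laurent_degree_set Delta 0 (fratio e e').
Proof.
move=> eD e'D; exists 'X_(enum_rank e), U_(enum_rank e')%MM, 1%N; split=> //.
- by rewrite poly_inX mono_inU.
- exact: mono_inU.
- by rewrite dhomogX /= mdeg1.
- by rewrite mdeg1 subrr.
Qed.

Lemma degree0_fracS (Delta Gamma : {set E}) z : Delta \subset Gamma ->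
  laurent_degree_set (R := R) Delta 0 z -> laurent_degree_set Gamma 0 z.
Proof.
by move=> DG hz; apply: (@laurent_degreeS _ _ _ _ DG 0 (degree0_laurent hz)).
Qed.

Lemma fratio_id e : fratio e e = 1.
Proof. by rewrite /fratio divff // tofracX_neq0. Qed.

Lemma fratioM e1 e2 e3 : fratio e1 e2 * fratio e2 e3 = fratio e1 e3.
Proof. by rewrite /fratio mulrA divfK // tofracX_neq0. Qed.

(** Each term of the numerator has the degree of the denominator. Pairing a variable above with one
    below, a quotient of monomials of equal degree becomes a product of ratios of variables in
    [Delta]. *)
Lemma degree0_ind (Delta : {set E}) (T : {fraction S} -> Prop) :
  (forall c, T (fconst c)) ->
  (forall x y, T x -> T y -> T (x + y)) ->
  (forall x y, T x -> T y -> T (x * y)) ->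
  (forall e e', e \in Delta -> e' \in Delta -> T (fratio e e')) ->
  forall z, laurent_degree_set Delta 0 z -> T z.
Proof.
move=> Tc TD TM Tr _ [p [m [k [pD mD pk km ->]]]].
have {}km : k = mdeg m by lia.
rewrite {}km in pk.
have T0 : T 0 by have := Tc 0; rewrite /fconst mpolyC0 tofrac0.
rewrite [p]mpolyE rmorph_sum mulr_suml big_seq; apply: big_ind => // m' m'p.
rewrite -mul_mpolyC rmorphM -mulrA; apply: (TM); first exact: Tc.
have {pk} : mdeg m' = mdeg m by apply: (dhomog_mf pk).
have {pD m'p p} : mono_in Delta m' by apply: (allP pD).
move dE: (mdeg m) => d; elim: d m m' dE mD => [|d IH] m m' dE mD m'D d'E.
  move: dE d'E => /eqP; rewrite mdeg_eq0 => /eqP-> /eqP.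
  rewrite mdeg_eq0 => /eqP->.
  rewrite mpolyX0 rmorph1 divr1.
  by have := Tc 1; rewrite /fconst mpolyC1 tofrac1.
have split_var (a : M) : mono_in Delta a -> mdeg a = d.+1 -> exists i b,
    [/\ i \in Delta, mono_in Delta b, mdeg b = d &
        a = (U_(enum_rank i) + b)%MM].
  move=> aD ad; have [i ai] : exists i, a i != 0%N.
    apply/existsP; rewrite -[[exists _, _]]negbK negb_exists; apply/negP.
    move=> /forallP a0; suff a00 : a = 0%MM by rewrite a00 mdeg0 in ad.
    by apply/mnmP => i; rewrite mnm0E; apply/eqP; have := a0 i; rewrite negbK.
  have aE : a = (U_(i) + (a - U_(i)))%MM.
    by rewrite addmC submK // lep1mP.
  exists (enum_val i), (a - U_(i))%MM; rewrite enum_valK; split=> //.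
  - by have /forallP/(_ i)/implyP := aD; apply.
  - apply/forallP => j; apply/implyP; rewrite mnmBE => aj.
    by have /forallP/(_ j)/implyP := aD; apply; lia.
  - by move: ad; rewrite {1}aE mdegD mdeg1; lia.
have [j [b [jD bD bd ->]]] := split_var m mD dE.
have [i [b' [iD b'D b'd ->]]] := split_var m' m'D d'E.
rewrite !mpolyXD !rmorphM -mulf_div; apply: (TM); first exact: Tr.
exact: IH.
Qed.

(** Universal property of localization. The value is pinned down by all fractions [p / 'X_[m]]
    representing [z] at once, and the invertibility of each [ev 'X_[m]] makes it unique. *)
Lemma laurent_lift_exists (Delta : {set E}) (B : comPzRingType)
    (ev : {rmorphism S -> B}) :
  (forall m, exists b, b * ev 'X_[m] = 1) ->
  exists Phi : {rmorphism laurent R Delta -> B}, forall z p m,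
    sval z = tofrac p / tofrac 'X_[m] -> Phi z * ev 'X_[m] = ev p.
Proof.
move=> evU.
have cancel m x y : x * ev 'X_[m] = y * ev 'X_[m] -> x = y.
  have [b bm] := evU m => xy.
  by rewrite -[x]mulr1 -[y]mulr1 -bm [b * _]mulrC !mulrA xy.
have exf (z : laurent R Delta) : exists b, forall p m,
    sval z = tofrac p / tofrac 'X_[m] -> b * ev 'X_[m] = ev p.
  have [q [m [_ _ zE]]] : laurent_set Delta (sval z) := subring_typeP z.
  have [b bm] := evU m; exists (b * ev q) => p m'; rewrite zE => /eqP.
  rewrite eqr_div ?tofracX_neq0 // -!rmorphM tofrac_eq => /eqP qp.
  by rewrite -mulrA -rmorphM qp rmorphM mulrCA bm mulr1.
have [f fE] := choice exf.
have fB : zmod_morphism f.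
  move=> x y.
  have [p [m [_ _ xE]]] : laurent_set Delta (sval x) := subring_typeP x.
  have [q [m' [_ _ yE]]] : laurent_set Delta (sval y) := subring_typeP y.
  apply: (cancel (m + m')%MM).
  rewrite (fE _ (p * 'X_[m'] - q * 'X_[m])); last first.
    by rewrite laurent_valB xE yE tofrac_divB.
  rewrite rmorphB !rmorphM -(fE x p m xE) -(fE y q m' yE) mpolyXD rmorphM.
  by ring.
have fM : monoid_morphism f.
  split.
    have := fE 1 1 0%MM; rewrite mpolyX0 !rmorph1 mulr1; apply.
    by rewrite invr1 mulr1.
  move=> x y.
  have [p [m [_ _ xE]]] : laurent_set Delta (sval x) := subring_typeP x.
  have [q [m' [_ _ yE]]] : laurent_set Delta (sval y) := subring_typeP y.
  apply: (cancel (m + m')%MM).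
  rewrite (fE _ (p * q)); last first.
    by rewrite laurent_valM xE yE tofrac_divM.
  rewrite !rmorphM -(fE x p m xE) -(fE y q m' yE) mpolyXD rmorphM.
  by ring.
pose fzmod := GRing.isZmodMorphism.Build _ _ f fB.
pose fmonoid := GRing.isMonoidMorphism.Build _ _ f fM.
by exists (HB.pack_for {rmorphism laurent R Delta -> B} f fzmod fmonoid).
Qed.

(** * Values of a ring map at degree-0 fractions *)

Section Value.
Variables (Delta : {set E}) (J : ideal (laurent R Delta)) (B : comPzRingType).
Variable phi : {rmorphism degree0_quot J -> B}.

Definition degree0_class z (hz : laurent_degree_set Delta 0 z) :
    degree0_quot J :=
  subring_elt (P := degree0_subring J)
    (ex_intro2 _ _ (degree0_laurent hz) hz erefl).

Lemma degree0_class_surj u :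
  exists z (hz : laurent_degree_set Delta 0 z), u = degree0_class hz.
Proof.
have [z z0 uz] : degree0_set (sval u) := subring_typeP u.
exists (sval z), z0; apply: val_inj; rewrite [LHS]uz /=; congr quot_pi.
exact: val_inj.
Qed.

(** Extended by 0 to the whole fraction field, so that maps out of the rings of different cells can
    be compared at the same fraction without carrying membership proofs. *)
Definition degree0_value (z : {fraction S}) : B :=
  if pselect (laurent_degree_set Delta 0 z) is left hz
  then phi (degree0_class hz) else 0.

Lemma degree0_valueE z (hz : laurent_degree_set Delta 0 z) :
  degree0_value z = phi (degree0_class hz).
Proof.
rewrite /degree0_value; case: pselect => // hz'.
by congr (phi _); apply: val_inj; rewrite /=; congr quot_pi; apply: val_inj.
Qed.

Lemma degree0_value1 : degree0_value 1 = 1.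
Proof.
rewrite (degree0_valueE (degree0_frac1 _)) -(rmorph1 phi); congr (phi _).
apply: val_inj; rewrite /= -[RHS](rmorph1 (quot_pi J)); congr quot_pi.
exact: val_inj.
Qed.

Lemma degree0_valueB x y :
  laurent_degree_set Delta 0 x -> laurent_degree_set Delta 0 y ->
  degree0_value (x - y) = degree0_value x - degree0_value y.
Proof.
move=> hx hy; rewrite (degree0_valueE hx) (degree0_valueE hy).
rewrite (degree0_valueE (degree0_fracB hx hy)) -rmorphB; congr (phi _).
apply: val_inj; rewrite rmorphB /= -rmorphB; congr quot_pi.
by apply: val_inj; rewrite rmorphB.
Qed.

Lemma degree0_valueM x y :
  laurent_degree_set Delta 0 x -> laurent_degree_set Delta 0 y ->
  degree0_value (x * y) = degree0_value x * degree0_value y.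
Proof.
move=> hx hy; rewrite (degree0_valueE hx) (degree0_valueE hy).
rewrite (degree0_valueE (degree0_fracM hx hy)) -rmorphM; congr (phi _).
apply: val_inj; rewrite rmorphM /= -rmorphM; congr quot_pi.
by apply: val_inj; rewrite rmorphM.
Qed.

Lemma degree0_valueD x y :
  laurent_degree_set Delta 0 x -> laurent_degree_set Delta 0 y ->
  degree0_value (x + y) = degree0_value x + degree0_value y.
Proof.
move=> hx hy; rewrite -[in RHS](addrK y x) degree0_valueB ?subrK //.
exact: degree0_fracD.
Qed.

Lemma degree0_value_eq0 z (hz : laurent_degree_set Delta 0 z) :
  J (degree0_laurent hz) -> degree0_value z = 0.
Proof.
move=> Jz; rewrite (degree0_valueE hz) -(rmorph0 phi); congr (phi _).
apply: val_inj; rewrite /= -(rmorph0 (quot_pi J)); apply/quot_pi_eq.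
by rewrite subr0.
Qed.

End Value.

Lemma degree0_value_inj (Delta : {set E}) (J : ideal (laurent R Delta))
    (B : comPzRingType) (phi phi' : {rmorphism degree0_quot J -> B}) :
  (forall z, laurent_degree_set Delta 0 z ->
    degree0_value phi z = degree0_value phi' z) -> phi =1 phi'.
Proof.
move=> eq_phi u; have [z [hz ->]] := degree0_class_surj u.
by rewrite -!degree0_valueE eq_phi.
Qed.

Lemma degree0_value_exists (Delta : {set E}) (J : ideal (laurent R Delta))
    (B : comPzRingType) (Phi : {rmorphism laurent R Delta -> B}) :
  (forall z, J z -> Phi z = 0) ->
  exists phi : {rmorphism degree0_quot J -> B},
    forall z (hz : laurent_degree_set Delta 0 z),
      degree0_value phi z = Phi (degree0_laurent hz).
Proof.
move=> PhiJ; have [g gE] := quot_lift_exists PhiJ.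
exists (g \o (val : {rmorphism degree0_quot J -> quot J})) => z hz.
by rewrite (degree0_valueE _ hz) /= gE.
Qed.

(** Turns compatibility with the maps of the diagram into equality of values at fractions. *)
Lemma degree0_value_incl (Delta Gamma : {set E}) (DG : Delta \subset Gamma)
    (J : ideal (laurent R Delta)) (K : ideal (laurent R Gamma))
    (JK : forall z, J z -> K (laurent_incl R DG z))
    (B : comPzRingType) (phi : {rmorphism degree0_quot K -> B}) z :
  laurent_degree_set Delta 0 z ->
  degree0_value (phi \o degree0_quot_incl JK) z = degree0_value phi z.
Proof.
move=> hz; rewrite (degree0_valueE _ hz).
rewrite (degree0_valueE _ (degree0_fracS DG hz)) /=; congr (phi _).
have uE : sval (degree0_class J hz) = quot_pi J (degree0_laurent hz) by [].
apply: val_inj; rewrite [LHS](degree0_quot_inclE JK uE).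
by congr quot_pi; apply: val_inj.
Qed.

(** The target is a bare ring, so its structure of algebra over the constants has to be read off
    from [phi]. *)
Lemma degree0_value_const (Delta : {set E}) (J : ideal (laurent R Delta))
    (B : comPzRingType) (phi : {rmorphism degree0_quot J -> B}) :
  exists iota : {rmorphism C -> B},
    forall c, iota c = degree0_value phi (fconst c).
Proof.
pose f c := degree0_value phi (fconst c).
have h c := degree0_fconst Delta c.
have fB : zmod_morphism f.
  by move=> x y; rewrite /f -degree0_valueB // /fconst mpolyCB tofracB.
have fM : monoid_morphism f.
  split; first by rewrite /f /fconst mpolyC1 tofrac1 degree0_value1.
  by move=> x y; rewrite /f -degree0_valueM // /fconst mpolyCM tofracM.
pose fzmod := GRing.isZmodMorphism.Build _ _ f fB.
pose fmonoid := GRing.isMonoidMorphism.Build _ _ f fM.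
by exists (HB.pack_for {rmorphism C -> B} f fzmod fmonoid).
Qed.

End LaurentDegree0.

(** * The colimit of the cell rings *)

Section Colimit.
Variables (R : realType) (E : finType).
Local Notation C := R[i].
Local Notation S := {mpoly C[#|E|]}.
Local Notation M := 'X_{1..#|E|}.
Local Notation tofrac := (@FracField.tofrac S).
Local Notation fconst := (@fconst R E).
Local Notation fratio := (@fratio R E).
Variables (I : ideal S) (w : E -> R).
Hypothesis hI : homogeneous_ideal I.
Hypothesis nmI : contains_no_monomial I.
Hypothesis cover : forall e : E,
  exists2 Delta : {set E}, Theta I w Delta & e \in Delta.

Local Notation V := ('Hom(lineality_dual I, R^o)).
Local Notation height e := (fun f : V => (f (vector_config I e) + w e : R)).

Lemma height_affine e (t : R) (f g : V) :
  height e ((1 - t) *: f + t *: g) = (1 - t) * height e f + t * height e g.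
Proof.
by rewrite /= add_lfunE !scale_lfunE /GRing.scale /=; ring.
Qed.

Definition cell_of (f : V) : cell I w :=
  exist _ (minimizers (fun e => height e f)) (asboolT (ex_intro _ f erefl)).

Lemma cell_ofP (Delta : cell I w) : exists f, Delta = cell_of f.
Proof. by have [f fE] := cellP Delta; exists f; apply: val_inj. Qed.

Lemma cell_cap (Delta Gamma : cell I w) e :
  e \in sval Delta -> e \in sval Gamma ->
  exists Lambda : cell I w, sval Lambda = sval Delta :&: sval Gamma.
Proof.
have [f ->] := cell_ofP Delta; have [g ->] := cell_ofP Gamma => ef eg.
exists (cell_of ((1 - 2^-1) *: f + 2^-1 *: g)).
exact: (argmin_midpoint (u := fun e => height e) height_affine ef eg).
Qed.

Lemma cover_cell e : exists Delta : cell I w, e \in sval Delta.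
Proof.
by have [Delta TD eD] := cover e; exists (exist _ Delta (asboolT TD)).
Qed.

Lemma met_cell e : met (fun e => height e) (fun _ => True) e.
Proof.
have [Delta] := cover_cell e; have [f ->] := cell_ofP Delta => ef.
by exists f.
Qed.

Lemma convexT : @convex_set R V (fun _ => True).
Proof. by []. Qed.

Lemma cells_connected (T : Type) (q : E -> T) :
  (forall (Delta : cell I w) e e', e \in sval Delta -> e' \in sval Delta ->
    q e = q e') -> forall e e', q e = q e'.
Proof.
move=> qD e e'.
apply: (cover_connected (u := fun e => height e) height_affine convexT);
  try exact: met_cell.
by move=> f a b _ af bf; apply: (qD (cell_of f)).
Qed.

Lemma cells_cocycle (B : comPzRingType) (c : E -> E -> B) :
  (forall e, c e e = 1) ->
  (forall (Delta : cell I w) e1 e2 e3, e1 \in sval Delta -> e2 \in sval Delta ->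
    e3 \in sval Delta -> c e1 e2 * c e2 e3 = c e1 e3) ->
  exists P P' : E -> B, (forall e, P e * P' e = 1) /\
    forall (Delta : cell I w) e e', e \in sval Delta -> e' \in sval Delta ->
      c e e' = P e * P' e'.
Proof.
move=> c1 cM.
have [|P [P' [PV PE]]] := cocycle_trivial (u := fun e => height e)
  height_affine convexT c1.
  by move=> f a b d _ af bf df; apply: (cM (cell_of f)).
exists P, P'; split=> // Delta e e'.
by have [f ->] := cell_ofP Delta; apply: (PE f).
Qed.

Lemma cell_inhabited (e : E) (Delta : cell I w) : exists e', e' \in sval Delta.
Proof.
have [f ->] := cell_ofP Delta.
exact: (minimizers_nonempty (fun e => height e f) e).
Qed.

Variable B : comPzRingType.

(** Only ratios of labels in no common cell need an argument: the discrepancy of [phi] and [phi'] at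
    a ratio does not change when a label moves within a cell, and cells connect all labels. *)
Lemma total_value_unique (phi phi' : {rmorphism R_total I w -> B}) :
  (forall (Delta : cell I w) z, laurent_degree_set (sval Delta) 0 z ->
    degree0_value phi z = degree0_value phi' z) -> phi =1 phi'.
Proof.
move=> eqD; apply: degree0_value_inj.
have DT (Delta : {set E}) z : laurent_degree_set (R := R) Delta 0 z ->
    laurent_degree_set [set: E] 0 z.
  by apply: degree0_fracS; apply: finset.subsetT.
have rT e e' : laurent_degree_set [set: E] 0 (fratio e e').
  by apply: degree0_fratio; rewrite in_setT.
have ratioM (psi : {rmorphism R_total I w -> B}) e1 e2 e3 :
    degree0_value psi (fratio e1 e3) =
    degree0_value psi (fratio e1 e2) * degree0_value psi (fratio e2 e3).
  by rewrite -degree0_valueM // fratioM.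
have ratio1 (psi : {rmorphism R_total I w -> B}) e :
    degree0_value psi (fratio e e) = 1.
  by rewrite fratio_id degree0_value1.
(* Membership in degree 0 is carried along the induction because [degree0_value] is additive and
   multiplicative only there. *)
suff T z : laurent_degree_set [set: E] 0 z ->
    laurent_degree_set [set: E] 0 z /\
    degree0_value phi z = degree0_value phi' z.
  by move=> z /T[].
move: z; apply: degree0_ind =>
  [c|x y [hx xE] [hy yE]|x y [hx xE] [hy yE]|e e' _ _].
- split; first exact: degree0_fconst.
  apply: (eqD (cell_of 0)); exact: degree0_fconst.
- by split; [exact: degree0_fracD|rewrite !degree0_valueD // xE yE].
- by split; [exact: degree0_fracM|rewrite !degree0_valueM // xE yE].
split; first exact: rT.
have q1 :
    degree0_value phi (fratio e e') * degree0_value phi' (fratio e' e) = 1.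
  transitivity
    (degree0_value phi (fratio e' e') * degree0_value phi' (fratio e' e')).
    apply: (cells_connected (q := fun a => degree0_value phi (fratio a e') *
      degree0_value phi' (fratio e' a))) => Delta a b aD bD.
    have ab :
        degree0_value phi (fratio a b) * degree0_value phi' (fratio b a) = 1.
      by rewrite (eqD Delta) -?ratioM ?ratio1 //; apply: degree0_fratio.
    rewrite (ratioM phi a b e') (ratioM phi' e' b a).
    by rewrite [X in _ * X]mulrC mulrACA ab mul1r.
  by rewrite !ratio1 mulr1.
by rewrite -[LHS]mulr1 -(ratio1 phi' e) (ratioM phi' e e' e) [X in _ * X]mulrC
  mulrA q1 mul1r.
Qed.

(** * Gluing compatible maps on the cell rings *)

Section Glue.
Variable phi : forall Delta : cell I w, {rmorphism R_cell I (sval Delta) -> B}.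
Hypothesis phi_compat : forall (Delta Gamma : cell I w)
  (DG : sval Delta \subset sval Gamma) z,
  laurent_degree_set (sval Delta) 0 z ->
  degree0_value (phi Gamma) z = degree0_value (phi Delta) z.

(** The shared label makes the intersection a cell, to which both maps restrict. *)
Lemma cell_value_overlap (Delta Gamma : cell I w) e z :
  e \in sval Delta -> e \in sval Gamma ->
  laurent_degree_set (sval Delta :&: sval Gamma) 0 z ->
  degree0_value (phi Delta) z = degree0_value (phi Gamma) z.
Proof.
move=> eD eG; have [Lambda LE] := cell_cap eD eG; rewrite -LE => hz.
have LD : sval Lambda \subset sval Delta by rewrite LE subsetIl.
have LG : sval Lambda \subset sval Gamma by rewrite LE subsetIr.
by rewrite (phi_compat LD hz) (phi_compat LG hz).
Qed.

(** Cells with a common label agree on constants, so the value is a function of the label, and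
    [cells_connected] makes it constant. *)
Lemma cell_value_const (Delta Gamma : cell I w) c :
  degree0_value (phi Delta) (fconst c) = degree0_value (phi Gamma) (fconst c).
Proof.
have [e0 _|E0] := pickP E; last first.
  suff -> : Delta = Gamma by [].
  by apply: val_inj; apply/setP => e; have := E0 e.
have exq e : exists b, forall Delta : cell I w, e \in sval Delta ->
    degree0_value (phi Delta) (fconst c) = b.
  have [Lambda eL] := cover_cell e.
  exists (degree0_value (phi Lambda) (fconst c)) => Delta' eD.
  by apply: (cell_value_overlap eD eL); apply: degree0_fconst.
have [q qE] := choice exq.
have [e eD] := cell_inhabited e0 Delta.
have [e' e'G] := cell_inhabited e0 Gamma.
rewrite (qE e) // (qE e') //; apply: cells_connected => Lambda a b aL bL.
by rewrite -(qE a Lambda) // (qE b).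
Qed.

Lemma cell_value_ratio : exists P P' : E -> B, (forall e, P e * P' e = 1) /\
  forall (Delta : cell I w) e e', e \in sval Delta -> e' \in sval Delta ->
    degree0_value (phi Delta) (fratio e e') = P e * P' e'.
Proof.
have exc (ee : E * E) : exists b, forall Delta : cell I w,
    ee.1 \in sval Delta -> ee.2 \in sval Delta ->
    degree0_value (phi Delta) (fratio ee.1 ee.2) = b.
  have [[Lambda [eL e'L]]|none] := EM (exists Lambda : cell I w,
      ee.1 \in sval Lambda /\ ee.2 \in sval Lambda).
    exists (degree0_value (phi Lambda) (fratio ee.1 ee.2)) => Delta eD e'D.
    apply: (cell_value_overlap eD eL).
    by apply: degree0_fratio; rewrite in_setI ?eD ?e'D.
  (* Pairs in no common cell get the arbitrary value 0, since the cocycle condition is tested only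
     inside cells. *)
  by exists 0 => Delta eD e'D; case: none; exists Delta.
have [c cE] := choice exc.
have {}cE (Delta : cell I w) e e' : e \in sval Delta -> e' \in sval Delta ->
    degree0_value (phi Delta) (fratio e e') = c (e, e').
  exact: (cE (e, e') Delta).
have [|Delta e1 e2 e3 h1 h2 h3|P [P' [PV PE]]] :=
  @cells_cocycle B (fun e e' => c (e, e')).
- move=> e; have [Delta eD] := cover_cell e.
  by rewrite -(cE Delta) // fratio_id degree0_value1.
- by rewrite -!(cE Delta) // -degree0_valueM ?fratioM //; apply: degree0_fratio.
exists P, P'; split=> // Delta e e' eD e'D; rewrite cE //; exact: (PE Delta).
Qed.

(** Without variables a nonzero polynomial is a unit, and [I] would contain the monomial 1. *)
Lemma ideal_no_vars (p : S) : #|E| = 0%N -> I p -> p = 0.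
Proof.
move=> E0; rewrite (mpoly_no_vars p E0) => Ip.
have [->|c0] := eqVneq p@_(0%MM) 0; first by rewrite mpolyC0.
case: (nmI (m := 0%MM)); rewrite mpolyX0.
have := idealMl ((p@_(0%MM))^-1)%:MP Ip.
by rewrite -mpolyCM mulVf // mpolyC1.
Qed.

(** Evaluation of each variable at the unit [P e] extends to Laurent polynomials, agrees with every
    [phi Delta] in degree 0, and therefore kills the generators of [total_ideal]. *)
Lemma total_value_exists : exists Phi : {rmorphism R_total I w -> B},
  forall (Delta : cell I w) z, laurent_degree_set (sval Delta) 0 z ->
    degree0_value Phi z = degree0_value (phi Delta) z.
Proof.
have [P [P' [PV PE]]] := cell_value_ratio.
have [iota iotaE] := degree0_value_const (phi (cell_of 0)).
have [ev [evC evX]] :=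
  mpoly_eval_exists iota (fun i : 'I_#|E| => P (enum_val i)).
have evX' e : ev 'X_(enum_rank e) = P e by rewrite evX enum_rankK.
have evU m : exists b, b * ev 'X_[m] = 1.
  exists (\prod_i (P' (enum_val i)) ^+ m i).
  rewrite mpolyXE_id rmorph_prod -big_split big1 // => i _.
  by rewrite rmorphXn /= evX -exprMn mulrC PV expr1n.
have [Phi PhiE] := @laurent_lift_exists R E [set: E] B ev evU.
have DT (Delta : {set E}) z : laurent_degree_set (R := R) Delta 0 z ->
    laurent_degree_set [set: E] 0 z.
  by apply: degree0_fracS; apply: finset.subsetT.
have agree (Delta : cell I w) z (hz : laurent_degree_set (sval Delta) 0 z) :
    Phi (degree0_laurent (DT _ _ hz)) = degree0_value (phi Delta) z.
  (* The membership proof is made existential so that the claim depends on [z] alone and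
     [degree0_ind] applies. *)
  suff [hz' <-] : exists hz' : laurent_degree_set (sval Delta) 0 z,
      Phi (degree0_laurent (DT _ _ hz')) = degree0_value (phi Delta) z.
    by congr (Phi _); apply: val_inj.
  move: z hz; apply: degree0_ind =>
    [c|x y [hx xE] [hy yE]|x y [hx xE] [hy yE]|e e' eD e'D].
  - exists (degree0_fconst _ c).
    have := PhiE (degree0_laurent (DT _ _ (degree0_fconst (sval Delta) c)))
      c%:MP 0%MM.
    rewrite mpolyX0 !rmorph1 !mulr1 invr1 mulr1 => -> //.
    by rewrite evC iotaE; apply: cell_value_const.
  - exists (degree0_fracD hx hy); rewrite degree0_valueD // -xE -yE -rmorphD.
    by congr (Phi _); apply: val_inj.
  - exists (degree0_fracM hx hy); rewrite degree0_valueM // -xE -yE -rmorphM.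
    by congr (Phi _); apply: val_inj.
  exists (degree0_fratio R eD e'D).
  have := PhiE (degree0_laurent (DT _ _ (degree0_fratio R eD e'D)))
    'X_(enum_rank e) U_(enum_rank e')%MM.
  rewrite !evX' => /(_ erefl) PhiP.
  by rewrite (PE Delta) // -PhiP -mulrA PV mulr1.
have ev_rho_homog (Delta : cell I w) p d : I p -> p \is d.-homog ->
    ev (rho (sval Delta) p) = 0.
  move=> Ip pd.
  have [e _|E0] := pickP E; last first.
    rewrite (ideal_no_vars _ Ip); last exact: eq_card0.
    by rewrite /rho comp_mpoly0 rmorph0.
  have {e}[e eD] := cell_inhabited e Delta.
  (* Dividing by the [d]-th power of a variable of the cell brings the generator to degree 0, where
     [phi Delta] kills it. *)
  pose xd : M := (U_(enum_rank e) *+ d)%MM.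
  have xdE : 'X_[xd] = 'X_(enum_rank e) ^+ d :> S by rewrite mpolyXn.
  pose z := tofrac (rho (sval Delta) p) / tofrac 'X_[xd].
  have xdD : mono_in (sval Delta) xd.
    rewrite -(poly_inX R) xdE; elim: (d) => [|k IH].
      by rewrite expr0 poly_in1.
    by rewrite exprS; apply: poly_inM => //; rewrite poly_inX mono_inU.
  have hz : laurent_degree_set (sval Delta) 0 z.
    exists (rho (sval Delta) p), xd, d; split=> //.
    - exact: poly_in_rho.
    - rewrite dhomogE; apply/allP => m.
      rewrite rhoE msupp_mselect => /andP[_ mp].
      by rewrite /= (dhomog_mf pd).
    - by rewrite mdegMn mdeg1 mul1n subrr.
  rewrite -(PhiE (degree0_laurent (DT _ _ hz)) _ xd erefl) agree.
  rewrite (@degree0_value_eq0 _ _ _ _ _ (phi Delta) z hz) ?mul0r //.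
  have pD : laurent_set (R := R) (sval Delta) (tofrac (rho (sval Delta) p)).
    by apply: laurent_tofrac; apply: poly_in_rho.
  have xD : laurent_set (R := R) (sval Delta) (tofrac 'X_[xd])^-1.
    exists 1, xd; split; [exact: poly_in1|exact: xdD|by rewrite tofrac1 div1r].
  have -> : degree0_laurent hz = subring_elt (P := laurent_subring R _) xD *
      subring_elt (P := laurent_subring R _) pD.
    by apply: val_inj; rewrite [RHS]laurent_valM /= mulrC.
  by apply: idealMl; apply: ideal_gen_sub; exists p.
have ev_rho (Delta : cell I w) p : I p -> ev (rho (sval Delta) p) = 0.
  move=> Ip.
  (* Homogeneity of [I] puts every homogeneous component of [p] in [I]. *)
  rewrite [in LHS](pihomog_partitionE (mf := mdeg) (leqnn (mmeasure mdeg p))).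
  rewrite rhoE mselect_sum rmorph_sum big1 // => d _; rewrite -rhoE.
  exact: (ev_rho_homog Delta _ d (hI d Ip) (pihomogP _ _ _)).
have PhiJ z : total_ideal I w z -> Phi z = 0.
  apply: ideal_gen_kernel => y [Delta TD [p Ip yE]].
  have := PhiE y (rho Delta p) 0%MM.
  rewrite mpolyX0 !rmorph1 mulr1 invr1 mulr1 yE => -> //.
  exact: (ev_rho (exist _ Delta (asboolT TD))).
have [phiT phiTE] := degree0_value_exists PhiJ.
exists phiT => Delta z hz; rewrite -(agree _ _ hz); exact: phiTE.
Qed.

End Glue.
End Colimit.

(** * The Yoneda lemma for affine schemes *)

Section Yoneda.
Variables (F : functor ring_cat type_cat) (A : comPzRingType).
Variables (i : nat_trans F (Spec_points A)) (j : nat_trans (Spec_points A) F).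
Hypothesis ji : forall (T : comPzRingType) (x : (F T : Type)), j T (i T x) = x.

Definition universal_point : (F A : Type) := j A (idfun : {rmorphism A -> A}).

Lemma universal_pointE (T : comPzRingType) (x : (F T : Type)) :
  fmap F (i T x : @Defs.hom ring_cat A T) universal_point = x.
Proof.
have := congr1 (fun k => k (idfun : {rmorphism A -> A}))
  (component_natural j (i T x : @Defs.hom ring_cat A T)).
rewrite /= => <-.
rewrite -[RHS]ji; congr (j _ _); exact: rmorphism_ext.
Qed.

(** Every point of [F] is the image of the universal point under a ring map from [A], so naturality
    determines [t] by its value there. *)
Lemma Spec_yoneda (B : comPzRingType) (t : nat_trans F (Spec_points B))
    (T : comPzRingType) (x : (F T : Type)) :
  (t T x : {rmorphism B -> T}) =1
    (i T x : {rmorphism A -> T}) \o (t A universal_point : {rmorphism B -> A}).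
Proof.
move=> b; rewrite -{1}(universal_pointE x).
exact: (congr1 (fun k => (k universal_point : {rmorphism B -> T}) b)
  (component_natural t (i T x : @Defs.hom ring_cat A T))).
Qed.

End Yoneda.

(** * The limit of the cell schemes *)

Theorem theorem6p3 (R : realType) (E : finType)
    (I : ideal {mpoly R[i][#|E|]}) (w : E -> R)
    (hI : homogeneous_ideal I)
    (nmI : contains_no_monomial I)
    (nmw : contains_no_monomial (initial_ideal w I))
    (cover : forall e : E,
      exists2 Delta : {set E}, Theta I w Delta & e \in Delta) :
  @is_limit (opposite (cell_poset I w)) affine_scheme_cat
    (X_diagram w hI) (X_total I w) (X_cone w hI).
Proof.
move=> Y c'; have [A [i [j [ji _]]]] := points_representable Y.
have {}ji (T : comPzRingType) (x : (points Y T : Type)) : j T (i T x) = x.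
  exact: (congr1 (fun k : nat_trans (points Y) (points Y) => k T x) ji).
pose x0 := universal_point j.
(* The legs of the cone, evaluated at the universal point of [Y], become compatible ring maps into
   [A]. *)
pose phi (Delta : cell I w) : {rmorphism R_cell I (sval Delta) -> A} :=
  component (leg c' Delta) A x0.
have phi_compat (Delta Gamma : cell I w)
    (DG : sval Delta \subset sval Gamma) z :
    laurent_degree_set (sval Delta) 0 z ->
    degree0_value (phi Gamma) z = degree0_value (phi Delta) z.
  move=> hz; rewrite -(degree0_value_incl (cell_idealS hI DG)) //.
  have /(congr1 (fun t : nat_trans (points Y)
      (Spec_points (R_cell I (sval Delta))) => t A x0)) :=
    @leg_natural _ _ _ _ c' Gamma Delta DG.
  by move=> /= ->.
have [Phi PhiE] := total_value_exists hI nmI cover phi_compat.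
have Phi_incl Delta :
    Phi \o degree0_quot_incl (@total_idealS _ _ I w Delta) =1 phi Delta.
  apply: degree0_value_inj => z hz.
  by rewrite degree0_value_incl // (PhiE Delta).
exists (Defs.comp
  (Spec_map Phi : @Defs.hom affine_scheme_cat (Spec A) (X_total I w)) i).
split=> [Delta|h hE]; apply: nat_trans_ext => T; apply: funext => x;
  apply: rmorphism_ext => b.
  apply: etrans (esym (Spec_yoneda ji (c' Delta) x b)).
  exact: (congr1 (i T x : {rmorphism A -> T}) (Phi_incl Delta b)).
(* For uniqueness, [h] is likewise a ring map from [R_total] to [A], and it agrees with [Phi] on
   every cell. *)
apply: etrans (esym (Spec_yoneda ji h x b)).
apply: (congr1 (i T x : {rmorphism A -> T})).
apply: (total_value_unique cover) => Delta z hz.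
rewrite (PhiE Delta) // -(degree0_value_incl (@total_idealS _ _ I w Delta)) //.
have /(congr1 (fun t : nat_trans (points Y)
      (Spec_points (R_cell I (sval Delta))) => t A x0)) := hE Delta.
move=> /esym hA.
exact: (congr1 (fun f : {rmorphism R_cell I (sval Delta) -> A} =>
  degree0_value f z) hA).
Qed.
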